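(* Let $\alpha>0$ and $(a,b)\in\mathbb{R}^2$ with $a<b$. Then, for every $f\in L^1([a,b];\mathbb{R})$, we have $$J_a^\alpha\left(S_a^\alpha f\right)(x)=S_a^\alpha\left(J_a^\alpha f\right)(x)=\int_a^x f(y)\,dy,\quad \text{for a.e. } x\in[a,b].$$
   Context: Let $E_1(x)=\int_x^\infty \frac{e^{-t}}{t}\,dt$ for $x>0$ and $\mathcal{S}(t)=e^{-t}\int_0^\infty \frac{t^{s-1}}{\Gamma(s)}\,ds$ for $t>0$, where $\Gamma$ is the Gamma function. For $\alpha>0$, $a<b$ real and $f\in L^1([a,b];\mathbb{R})$, the left-sided fractional integrals of first and second kind of order $\alpha$ of $f$ are, for a.e. $x\in[a,b]$, $$(J_a^\alpha f)(x)=\frac{1}{\alpha}\int_a^x E_1\left(\frac{x-t}{\alpha}\right)f(t)\,dt,\qquad (S_a^\alpha f)(x)=\int_a^x \mathcal{S}\left(\frac{x-t}{\alpha}\right)f(t)\,dt.$$ *)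

(* Defs.v *)
From HB Require Import structures.
From mathcomp Require Import all_boot all_order all_algebra.
From mathcomp Require Import all_classical all_reals all_analysis.

Set Implicit Arguments.
Unset Strict Implicit.
Unset Printing Implicit Defensive.

Import Order.TTheory GRing.Theory Num.Theory.
Import numFieldNormedType.Exports.

Local Open Scope classical_set_scope.
Local Open Scope ring_scope.

(* All integrals are real-valued Lebesgue integrals ([Rintegral]), which return
   a default value when the integral does not exist. The functions below are
   therefore total; [Gamma], [E1] and [calS] are meaningful only at positive
   arguments, and [fracJ], [fracS] only at almost every x at or above the base
   point a, for an integrand f in L^1. *)

Definition Gamma {R : realType} (s : R) : R :=
  \int[lebesgue_measure]_(t in `]0, +oo[) (t `^ (s - 1) * expR (- t)).

Definition E1 {R : realType} (x : R) : R :=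
  \int[lebesgue_measure]_(t in `]x, +oo[) (expR (- t) / t).

Definition calS {R : realType} (t : R) : R :=
  expR (- t) *
  \int[lebesgue_measure]_(s in `]0, +oo[) (t `^ (s - 1) / Gamma s).

(* The kernels are singular at 0, that is at t = x; this endpoint is a null
   set and is left out of the domain of integration. *)

Definition fracJ {R : realType} (alpha a : R) (f : R -> R) (x : R) : R :=
  alpha^-1 *
  \int[lebesgue_measure]_(t in `]a, x[) (E1 ((x - t) / alpha) * f t).

Definition fracS {R : realType} (alpha a : R) (f : R -> R) (x : R) : R :=
  \int[lebesgue_measure]_(t in `]a, x[) (calS ((x - t) / alpha) * f t).

(* Main.v *)
(* Let g_s(t) = t^(s-1) e^(-t) / Gamma(s), s > 0, be the gamma densities on
   ]0, +oo[.  They form a convolution semigroup, calS is their potential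
   S = \int_0^oo g_s ds, and E1 is the tail of the Levy measure e^(-t)/t dt.
   Everything rests on the Sonine identity E1 * S = 1 on ]0, +oo[; the theorem
   then follows by Fubini, for every x and not merely almost every x.
   Let A_r(y) = \int_y^oo u^(r-1) e^(-u) du, so that A_0 = E1.  For r > 0, since
   A_r / Gamma(r) = 1 - 1 * g_r on ]0, +oo[, the semigroup property makes
   \int (1 * g_s) ds telescope:
     (A_r * S)(x) = Gamma(r) \int_0^r F_s(x) ds,  F_s(x) = \int_0^x g_s.
   Markov's inequality 1 - s/x <= F_s(x) <= 1 gives
     (1 - r/x) Gamma(1+r) <= (A_r * S)(x) <= Gamma(1+r),
   and r -> 0 yields (E1 * S)(x) = 1: the upper bound by Fatou's lemma, the lower
   one because u^r <= 1 + r u implies A_r * S <= A_0 * S + r (A_1 * S). *)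

Require Import Defs.
From HB Require Import structures.
From mathcomp Require Import all_boot all_order all_algebra.
From mathcomp Require Import all_classical all_reals all_analysis.
From mathcomp Require Import measurable_realfun ring lra.

Import Order.TTheory GRing.Theory Num.Theory.
Import numFieldNormedType.Exports.

Local Open Scope classical_set_scope.
Local Open Scope ring_scope.

Set Implicit Arguments.
Unset Strict Implicit.

(** * Affine changes of variable *)

Local Notation mu := lebesgue_measure.

Section affine.
Context {R : realType}.
Implicit Types f : R -> \bar R.
Local Open Scope ereal_scope.

Let maff (a b : R) : measurable_fun [set: measurableTypeR R]
  (fun x : measurableTypeR R => a * x + b : measurableTypeR R)%R.
Proof. by apply: measurable_funD => //; exact: measurable_funM. Qed.

(** Multiplied by [a], the pushforward of Lebesgue measure under the affine map agrees with Lebesgue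
    measure on half-open intervals, hence everywhere by uniqueness. *)
Lemma ge0_integral_affine (a b : R) f : (0 < a)%R ->
    measurable_fun [set: R] f -> (forall x, 0 <= f x) ->
  \int[mu]_x f (a * x + b)%R = a^-1%:E * \int[mu]_x f x.
Proof.
move=> a0 mf f0.
have ai0 : (0 <= a^-1)%R by rewrite invr_ge0 ltW.
have -> : \int[mu]_x f (a * x + b)%R =
    \int[pushforward mu (fun x : measurableTypeR R => a * x + b : measurableTypeR R)%R]_x f x.
  by rewrite (ge0_integral_pushforward (maff a b))// => x _; exact: f0.
have -> : a^-1%:E = (NngNum ai0)%:num%:E by [].
rewrite -ge0_integral_mscale//.
apply: eq_measure_integral => A mA _ /=.
pose m1 := mscale (NngNum (ltW a0))
  (measure_function_pushforward__canonical__measure_function_Measure mu (maff a b)).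
have : mu A = m1 A.
  apply: lebesgue_measure_unique => // _ [[c d] _ <-].
  transitivity (a%:E * mu `](c - b) / a, (d - b) / a]%classic%R); last first.
    congr (_ * mu _).
    apply/seteqP; split => x /=; rewrite !in_itv/= ltr_pdivrMr// ler_pdivlMr//;
    by rewrite ltrBlDr lerBrDr mulrC.
  rewrite !lebesgue_measure_itv/= !lte_fin ltr_pM2r ?invr_gt0// ltrD2r.
  case: ifPn => _; last by rewrite mule0.
  rewrite -!EFinB -EFinM; congr EFin; field; exact: lt0r_neq0.
move=> muA; rewrite -[RHS]/(a^-1%:E * mu A).
rewrite -[LHS]mul1e -(mulVf (lt0r_neq0 a0)) EFinM -muleA.
by congr (_ * _); rewrite -[RHS]/(mu A) muA.
Qed.

Lemma ge0_integral_shift (b : R) f :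
    measurable_fun [set: R] f -> (forall x, 0 <= f x) ->
  \int[mu]_x f (x + b)%R = \int[mu]_x f x.
Proof.
move=> mf f0; have := @ge0_integral_affine 1 b f ltr01 mf f0.
by rewrite invr1 mul1e => <-; apply: eq_integral => x _; rewrite mul1r.
Qed.

Lemma ge0_integral_reflect (b : R) f :
    measurable_fun [set: R] f -> (forall x, 0 <= f x) ->
  \int[mu]_x f (b - x)%R = \int[mu]_x f x.
Proof.
move=> mf f0; rewrite -[RHS](@ge0_integral_shift b)//.
have mg : measurable_fun [set: R] (fun x => f (x + b)%R).
  by apply: measurableT_comp => //; exact: measurable_funD.
transitivity (\int[pushforward mu (-%R : _ -> measurableTypeR R)]_x f (x + b)%R).
  rewrite ge0_integral_pushforward// preimage_setT.
  by apply: eq_integral => x _ /=; rewrite addrC.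
by apply: eq_measure_integral => A mA _; exact: lebesgue_measureN.
Qed.

End affine.

(** * Convolution of nonnegative functions *)

Section convolution.
Context {R : realType}.
Local Open Scope ereal_scope.
Implicit Types f g h : R -> \bar R.

Lemma ge0_integral_swap (k : R -> R -> \bar R) :
    measurable_fun setT (fun z : R * R => k z.1 z.2) -> (forall x y, 0 <= k x y) ->
  \int[mu]_x \int[mu]_y k x y = \int[mu]_y \int[mu]_x k x y.
Proof.
move=> mk k0.
exact: (@fubini_tonelli _ _ (measurableTypeR R) (measurableTypeR R) R mu mu
  (fun z => k z.1 z.2) mk (fun z => k0 z.1 z.2)).
Qed.

Lemma measurable_integral_snd (k : R -> R -> \bar R) :
    measurable_fun setT (fun z : R * R => k z.1 z.2) -> (forall x y, 0 <= k x y) ->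
  measurable_fun setT (fun x => \int[mu]_y k x y).
Proof.
move=> mk k0.
exact: (@measurable_fun_fubini_tonelli_F _ _ (measurableTypeR R) (measurableTypeR R) R mu
  (fun z => k z.1 z.2) mk (fun z => k0 z.1 z.2)).
Qed.

Lemma ge0_integral0 f : (forall x, 0 <= f x) -> 0 <= \int[mu]_x f x.
Proof. by move=> f0; apply: integral_ge0 => x _. Qed.

Lemma measurable_uncurry_swap (k : R -> R -> \bar R) :
  measurable_fun setT (fun z : R * R => k z.1 z.2) ->
  measurable_fun setT (fun z : R * R => k z.2 z.1).
Proof.
move=> mk; have /(measurableT_comp mk) := @measurable_fun_pair _ _ _ _ _ _ _ _
  (@measurable_snd _ _ R R) (@measurable_fst _ _ R R).
exact.
Qed.

(** Functions on the half-line are extended by 0, so that an integral over the whole line serves as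
    the Volterra convolution on ]0, x[; for nonnegative extended-real functions it always exists. *)
Definition convol f g x := \int[mu]_t (f (x - t)%R * g t).

Lemma convol_ge0 f g x : (forall x, 0 <= f x) -> (forall x, 0 <= g x) ->
  0 <= convol f g x.
Proof. by move=> f0 g0; apply: ge0_integral0 => t; exact: mule_ge0. Qed.

Lemma measurable_shear f : measurable_fun setT f ->
  measurable_fun setT (fun z : R * R => f (z.1 - z.2)%R).
Proof.
by move=> mf; apply: (measurableT_comp mf); exact: measurable_funB.
Qed.

Lemma measurable_convol f g : measurable_fun setT f -> measurable_fun setT g ->
  (forall x, 0 <= f x) -> (forall x, 0 <= g x) -> measurable_fun setT (convol f g).
Proof.
move=> mf mg f0 g0; apply: (@measurable_integral_snd (fun x t => f (x - t)%R * g t)).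
  by apply: emeasurable_funM; [exact: measurable_shear|exact: measurableT_comp].
by move=> x y; exact: mule_ge0.
Qed.

Lemma convolC f g : measurable_fun setT f -> measurable_fun setT g ->
  (forall x, 0 <= f x) -> (forall x, 0 <= g x) -> convol f g = convol g f.
Proof.
move=> mf mg f0 g0; apply/funext => x.
rewrite /convol -(@ge0_integral_reflect _ x (fun t => f (x - t)%R * g t)).
- by apply: eq_integral => t _; rewrite opprB addrC subrK muleC.
- apply: emeasurable_funM => //; apply: (measurableT_comp mf).
  exact: measurable_funB.
- by move=> y; exact: mule_ge0.
Qed.

(** Tonelli. It serves for associativity and for functions that are integrals over an index, such as
    the potential S. *)
Lemma convol_integral f (k : R -> R -> \bar R) x : measurable_fun setT f ->
    measurable_fun setT (fun z : R * R => k z.1 z.2) ->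
    (forall x, 0 <= f x) -> (forall s t, 0 <= k s t) ->
  convol f (fun t => \int[mu]_s k s t) x = \int[mu]_s convol f (k s) x.
Proof.
move=> mf mk f0 k0.
rewrite /convol [RHS]ge0_integral_swap; last 2 first.
- apply: emeasurable_funM => //; apply: (measurableT_comp mf).
  by apply: measurable_funB => //; exact: measurable_snd.
- by move=> s t; exact: mule_ge0.
apply: eq_integral => t _; rewrite ge0_integralZl//.
by have := measurable_fun_pair1 t mk.
Qed.

Lemma convolA f g h : measurable_fun setT f -> measurable_fun setT g ->
    measurable_fun setT h ->
    (forall x, 0 <= f x) -> (forall x, 0 <= g x) -> (forall x, 0 <= h x) ->
  convol f (convol g h) = convol (convol f g) h.
Proof.
move=> mf mg mh f0 g0 h0; apply/funext => x.
rewrite (@convol_integral f (fun t y => g (y - t)%R * h t))//; last 2 first.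
- by apply: emeasurable_funM;
    [exact: (@measurable_uncurry_swap (fun s t => g (s - t)%R) (measurable_shear mg))|
     exact: measurableT_comp].
- by move=> *; exact: mule_ge0.
apply: eq_integral => t _; rewrite /convol muleC -ge0_integralZl//; last 2 first.
- apply: emeasurable_funM => //; apply: (measurableT_comp mf).
  exact: measurable_funB.
- by move=> s _; exact: mule_ge0.
rewrite -[LHS](@ge0_integral_shift _ t); last 2 first.
- apply: emeasurable_funM; first by apply: (measurableT_comp mf); exact: measurable_funB.
  by apply: emeasurable_funM => //; apply: (measurableT_comp mg); exact: measurable_funB.
- by move=> s; rewrite !mule_ge0.
apply: eq_integral => s _.
by rewrite addrK opprD addrA addrAC muleA muleC.
Qed.

Lemma convolDl f1 f2 g x :  measurable_fun setT f1 -> measurable_fun setT f2 ->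
    measurable_fun setT g ->
    (forall x, 0 <= f1 x) -> (forall x, 0 <= f2 x) -> (forall x, 0 <= g x) ->
  convol (fun y => f1 y + f2 y) g x = convol f1 g x + convol f2 g x.
Proof.
move=> mf1 mf2 mg f10 f20 g0.
have mc f : measurable_fun setT f -> measurable_fun setT (fun t : R => f (x - t)%R).
  by move=> mf; apply: (measurableT_comp mf); exact: measurable_funB.
rewrite /convol -ge0_integralD//.
- by apply: eq_integral => t _; rewrite ge0_muleDl.
- by move=> *; exact: mule_ge0.
- by apply: emeasurable_funM => //; exact: mc.
- by move=> *; exact: mule_ge0.
- by apply: emeasurable_funM => //; exact: mc.
Qed.

End convolution.

(** * The gamma function *)

Section gamma_function.
Context {R : realType}.
Local Open Scope ereal_scope.
Implicit Types (s t l : R).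

(** The integrand of Gamma(s), extended by 0 to t <= 0. The power is written with exp and ln, so
    that products become sums of exponents; s = 0 gives the integrand of E1. *)
Definition gker s t : R := if (0 < t)%R then expR ((s - 1) * ln t - t) else 0%R.

Definition egamma s : \bar R := \int[mu]_t (gker s t)%:E.

Lemma gker_ge0 s t : (0 <= gker s t)%R.
Proof. by rewrite /gker; case: ifP => // _; exact: expR_ge0. Qed.

Lemma gker_npos s t : (t <= 0)%R -> gker s t = 0%R.
Proof. by rewrite /gker leNgt => /negPf ->. Qed.

Lemma gkerE s t : (0 < t)%R -> gker s t = expR ((s - 1) * ln t - t).
Proof. by rewrite /gker => ->. Qed.

Lemma measurable_gker2 : measurable_fun setT (fun z : R * R => gker z.1 z.2).
Proof.
apply: measurable_fun_ifT => //; first exact: measurable_fun_ltr.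
apply: measurableT_comp => //; apply: measurable_funB => //.
apply: measurable_funM; first exact: measurable_funB.
by apply: measurableT_comp => //; exact: measurable_ln.
Qed.

Lemma measurable_gker s : measurable_fun setT (gker s).
Proof.
by have := measurable_fun_pair2 s measurable_gker2.
Qed.

Lemma measurable_Egker s : measurable_fun setT (fun t => (gker s t)%:E).
Proof. by apply/measurable_EFinP; exact: measurable_gker. Qed.

Lemma measurable_egamma : measurable_fun setT egamma.
Proof.
apply: (@measurable_integral_snd _ (fun s t => (gker s t)%:E)).
  by apply/measurable_EFinP; exact: measurable_gker2.
by move=> *; rewrite lee_fin gker_ge0.
Qed.

Lemma egamma_ge0 s : 0 <= egamma s.
Proof. by apply: ge0_integral0 => t; rewrite lee_fin gker_ge0. Qed.

(** The substitution u = l t; the result is the Laplace transform l^(-s) Gamma(s) of t^(s-1). *)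
Lemma egamma_scale s l : (0 < l)%R ->
  \int[mu]_t (if 0 < t then expR ((s - 1) * ln t - l * t) else 0)%:E =
  (expR (- (s * ln l)))%:E * egamma s.
Proof.
move=> l0.
transitivity (\int[mu]_t ((expR (- ((s - 1) * ln l)))%:E * (gker s (l * t + 0))%:E)).
  apply: eq_integral => t _; rewrite -EFinM addr0 /gker pmulr_rgt0//.
  case: ifPn => t0; last by rewrite mulr0.
  by rewrite lnM// -expRD; congr (expR _)%:E; ring.
have mg : measurable_fun setT (fun t => (gker s t)%:E) by exact: measurable_Egker.
rewrite ge0_integralZl//; last 2 first.
- by apply: (measurableT_comp mg); apply: measurable_funD => //; exact: measurable_funM.
- by move=> *; rewrite lee_fin gker_ge0.
rewrite (@ge0_integral_affine R l 0%R (fun t => (gker s t)%:E))//; last first.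
  by move=> *; rewrite lee_fin gker_ge0.
rewrite muleA -EFinM; congr (_%:E * _).
by rewrite -[in X in (_ * X)%R](lnK l0) -expRN -expRD; congr expR; ring.
Qed.

(** The integrand is the exponential density of rate 1 except at t = 0, a null set. *)
Lemma egamma1 : egamma 1 = 1.
Proof.
rewrite -(@integral_exponential_pdf R 1)//; apply: ge0_ae_eq_integral => //.
- exact: measurable_Egker.
- by apply/measurable_EFinP; exact: measurable_exponential_pdf.
- by move=> *; rewrite lee_fin gker_ge0.
- by move=> *; rewrite lee_fin exponential_pdf_ge0.
exists [set 0%R]; split => //; first exact: lebesgue_measure_set1.
move=> t /=; apply: contra_notP => /eqP t0 _.
rewrite /exponential_pdf patchE /gker subrr mul0r add0r mul1r mulN1r.
have [t1|t1|t1] := ltgtP 0%R t.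
- by rewrite ifT// inE/= in_itv/= ltW.
- by rewrite ifF//; apply/negP; rewrite inE/= in_itv/= andbT leNgt t1.
- by rewrite -t1 eqxx in t0.
Qed.

(** The antiderivative -l^(-s) / s vanishes at infinity. This is the integral over l needed for
    [egammaS]. *)
Lemma integral_powR_tail s : (0 < s)%R ->
  \int[mu]_l (if 1 < l then expR (- ((s + 1) * ln l)) else 0)%:E = s^-1%:E.
Proof.
move=> s0.
pose F (l : R) : R := (- (s^-1 * expR (- (s * ln l))))%R.
have dF (l : R) : (0 < l)%R -> is_derive l (1%R : R) F (expR (- ((s + 1) * ln l)))%R.
  move=> l0; rewrite /F.
  have dln := is_derive1_ln l0.
  apply: is_derive_eq.
  rewrite /GRing.scale/= mulrDl mul1r opprD expRD [expR (- ln l)]expRN lnK//.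
  by field; rewrite !gt_eqF.
have cln (l : R) : (0 < l)%R -> {for l, continuous (fun l => expR (- ((s + 1) * ln l)))%R}.
  move=> l0; apply: continuous_comp; last exact: continuous_expR.
  by apply: cvgN; apply: cvgMr; exact: continuous_ln.
transitivity (\int[mu]_(l in `[1%R, +oo[) (expR (- ((s + 1) * ln l)))%:E).
  rewrite -integral_itv_obnd_cbnd; last first.
    apply/measurable_EFinP; apply: (measurable_funS measurableT) => //.
    apply: measurableT_comp => //; apply: measurable_funN.
    by apply: measurable_funM => //; exact: measurable_ln.
  rewrite [RHS]integral_mkcond; apply: eq_integral => l _.
  rewrite patchE; case: ifPn => l1; first by rewrite ifT// inE/= in_itv/= l1.
  by rewrite ifF//; apply/negP; rewrite inE/= in_itv/= andbT => l1'; rewrite l1' in l1.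
rewrite (@ge0_continuous_FTC2y _ _ F _ 0%R).
- by rewrite /F ln1 mulr0 oppr0 expR0 mulr1 add0e EFinN oppeK.
- by move=> l _; exact: expR_ge0.
- apply: continuous_in_subspaceT => l; rewrite inE/= in_itv/= andbT => l1.
  exact/cln/(lt_le_trans ltr01 l1).
- rewrite /F -oppr0; apply: cvgN; rewrite -(mulr0 s^-1%R); apply: cvgMr.
  apply/cvgrPdist_lt => e e0; near=> l.
  have l0 : (0 < l)%R by near: l; exact: nbhs_pinfty_gt.
  rewrite sub0r normrN ger0_norm ?expR_ge0//.
  rewrite -[ltRHS]lnK// ltr_expR ltrNl mulrC -ltr_pdivrMr//.
  rewrite -[ltLHS]expRK ltr_ln ?posrE ?expR_gt0//.
- by move=> l l1; have [] := dF l (lt_trans ltr01 l1).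
- apply: cvg_at_right_filter; apply: differentiable_continuous.
  by apply/derivable1_diffP; have [] := dF 1%R ltr01.
- move=> l; rewrite in_itv/= andbT => l1; rewrite derive1E.
  by have [_ ->] := dF l (lt_trans ltr01 l1).
Unshelve. all: by end_near. Qed.

(* Tonelli with 1/t e^(-t) = \int_1^oo e^(-l t) dl. *)
Lemma egammaS s : (0 < s)%R -> egamma (s + 1) = s%:E * egamma s.
Proof.
move=> s0.
pose k (t l : R) : R := if (0 < t)%R && (1 < l)%R then expR (s * ln t - l * t) else 0%R.
have mk : measurable_fun setT (fun z : R * R => (k z.1 z.2)%:E).
  apply/measurable_EFinP; apply: measurable_fun_ifT => //.
    by apply: measurable_and; exact: measurable_fun_ltr.
  apply: measurableT_comp => //; apply: measurable_funB; last exact: measurable_funM.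
  by apply: measurable_funM => //; apply: measurableT_comp => //; exact: measurable_ln.
have k0 t l : 0 <= (k t l)%:E by rewrite lee_fin /k; case: ifP => // _; exact: expR_ge0.
have -> : egamma s = \int[mu]_t \int[mu]_l (k t l)%:E.
  apply: eq_integral => t _; rewrite /k /gker; case: ltP => t0 /=; last by rewrite integral0.
  (* The substitution t l - t turns e^(-t l) on l > 1 into the exponential density, of mass one, and
     leaves a factor 1/t. *)
  transitivity (\int[mu]_l ((expR (s * ln t - t))%:E * (gker 1 (t * l + (- t)))%:E)).
    rewrite ge0_integralZl//.
    - rewrite (@ge0_integral_affine R t (- t)%R (fun t => (gker 1 t)%:E))//.
      + rewrite -/(egamma 1) egamma1 mule1 -EFinM; congr EFin.
        by rewrite -[in X in (_ * X^-1)%R](lnK t0) -expRN -expRD; congr expR; ring.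
      + exact: measurable_Egker.
      + by move=> *; rewrite lee_fin gker_ge0.
    - apply: (measurableT_comp (measurable_Egker 1)).
      by apply: measurable_funD => //; exact: measurable_funM.
    - by move=> *; rewrite lee_fin gker_ge0.
  apply: eq_integral => l _; rewrite -EFinM /gker.
  rewrite -[X in (0 < _ - X)%R]mulr1 -mulrBr pmulr_rgt0// subr_gt0.
  case: ifPn => _; last by rewrite mulr0.
  by rewrite -expRD; congr (expR _)%:E; ring.
rewrite (ge0_integral_swap (k := fun t l => (k t l)%:E))//.
(* In the other order, scaling evaluates the integral over t as l^(-s-1) Gamma(s + 1). *)
transitivity (s%:E * \int[mu]_l (egamma (s + 1) *
    (if (1 < l)%R then expR (- ((s + 1) * ln l)) else 0%R)%:E)).
  rewrite ge0_integralZl//.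
  - by rewrite integral_powR_tail// muleCA -EFinM mulfV ?gt_eqF// mule1.
  - apply/measurable_EFinP; apply: measurable_fun_ifT => //; first exact: measurable_fun_ltr.
    apply: measurableT_comp => //; apply: measurable_funN.
    by apply: measurable_funM => //; exact: measurable_ln.
  - by move=> l _; rewrite lee_fin; case: ifP => // _; exact: expR_ge0.
  - exact: egamma_ge0.
congr (_ * _); apply: eq_integral => l _.
rewrite /k; case: ltP => l1; last by rewrite mule0 integral0_eq// => t _; rewrite andbF.
rewrite muleC -egamma_scale ?(lt_trans ltr01)//; apply: eq_integral => t _.
by rewrite andbT addrK.
Qed.

End gamma_function.

(** * Bounds, finiteness and positivity of Gamma *)

Section gamma_bounds.
Context {R : realType}.
Implicit Types (r s t u x y : R).

Lemma le_ln_subr1 x : 0 < x -> ln x <= x - 1.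
Proof.
move=> x0; rewrite -ler_expR lnK ?posrE//.
by have := expR_ge1Dx (x - 1); rewrite addrC subrK.
Qed.

(** Weighted AM-GM for 1 and x. With m the weighted mean, it is the combination, with weights r and
    1 - r, of ln z <= z - 1 at z = x / m and at z = 1 / m: the right-hand sides cancel. *)
Lemma young_expR_ln r x : 0 <= r <= 1 -> 0 < x ->
  expR (r * ln x) <= (1 - r) + r * x.
Proof.
move=> /andP[r0 r1] x0.
have m0 : 0 < (1 - r) + r * x.
  have [->|rn0] := eqVneq r 0; first by rewrite subr0 mul0r addr0.
  by rewrite ltr_wpDl ?subr_ge0// mulr_gt0// lt0r rn0.
set m := (1 - r) + r * x in m0 *.
rewrite -[leRHS]lnK ?posrE// ler_expR.
have h1 := ler_wpM2l r0 (le_ln_subr1 (divr_gt0 x0 m0)).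
have h2 : (1 - r) * ln m^-1 <= (1 - r) * (m^-1 - 1).
  by apply: ler_wpM2l; [rewrite subr_ge0|apply: le_ln_subr1; rewrite invr_gt0].
rewrite lnM ?posrE ?invr_gt0// in h1.
rewrite lnV ?posrE// in h1 h2.
have h3 : r * (x / m - 1) + (1 - r) * (m^-1 - 1) = 0.
  transitivity (((1 - r) + r * x) / m - 1); first by ring.
  by rewrite -/m divff ?subrr// gt_eqF.
nra.
Qed.

Lemma gkerD s r u : 0 < u -> gker (s + r) u = gker s u * expR (r * ln u).
Proof. by move=> u0; rewrite !gkerE// -expRD; congr expR; ring. Qed.

Lemma gkerS s u : gker (s + 1) u = gker s u * u.
Proof.
have [u0|u0] := leP u 0; first by rewrite !gker_npos ?mul0r.
by rewrite gkerD// mul1r lnK.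
Qed.

(** As a convex function of r, u^r lies below its chord over [0, 1]. *)
Lemma gker_convex s r u : 0 <= r <= 1 ->
  gker (s + r) u <= (1 - r) * gker s u + r * gker (s + 1) u.
Proof.
move=> r01; have [u0|u0] := leP u 0; first by rewrite !gker_npos ?mulr0 ?addr0.
rewrite gkerS gkerD// mulrCA [(1 - r) * _]mulrC -mulrDr ler_wpM2l ?gker_ge0//.
exact: young_expR_ln.
Qed.

(** Up to the factor [gker s u] this is Bernoulli's inequality (1 + r) u <= r + u^(1+r), that is,
    [young_expR_ln] with weight 1/(1+r) at the point u^(1+r). *)
Lemma gker_concave s r u : 0 <= r ->
  (1 + r) * gker (s + 1) u <= r * gker s u + gker (s + 1 + r) u.
Proof.
move=> r0; have [u0|u0] := leP u 0; first by rewrite !gker_npos ?mulr0 ?addr0.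
have r1 : 0 < 1 + r by rewrite ltr_wpDr.
rewrite -addrA gkerS gkerD// mulrCA [r * _]mulrC -mulrDr ler_wpM2l ?gker_ge0//.
have := @young_expR_ln (1 + r)^-1 (expR ((1 + r) * ln u)).
rewrite expRK mulrA mulVf ?gt_eqF// mul1r lnK ?posrE// expR_gt0.
rewrite invr_ge0 ltW// invf_le1// lerDl r0 => /(_ isT isT) h.
rewrite mulrC -ler_pdivlMr//; apply: (le_trans h).
by rewrite le_eqVlt; apply/orP; left; apply/eqP; field; rewrite gt_eqF.
Qed.

Local Open Scope ereal_scope.

(** [gker_convex] at s = 1 bounds the integrand by a mean of those of Gamma(1) = 1 and Gamma(2) =
    1. *)
Lemma egamma_le1 r : (0 <= r <= 1)%R -> egamma (1 + r) <= 1.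
Proof.
move=> r01; have /andP[r0 r1] := r01.
have e2 : egamma (1 + 1) = 1 :> \bar R by rewrite egammaS// egamma1 mule1.
have -> : 1 = \int[mu]_u ((1 - r)%:E * (gker 1 u)%:E + r%:E * (gker (1 + 1) u)%:E).
  rewrite ge0_integralD//.
  - rewrite !ge0_integralZl ?lee_fin ?subr_ge0//.
    + by rewrite -/(egamma 1) -/(egamma (1 + 1)) e2 egamma1 !mule1 -EFinD subrK.
    + exact: measurable_Egker.
    + by move=> u _; rewrite lee_fin gker_ge0.
    + exact: measurable_Egker.
    + by move=> u _; rewrite lee_fin gker_ge0.
  - by move=> u _; rewrite mule_ge0// lee_fin ?subr_ge0// gker_ge0.
  - by apply: emeasurable_funM => //; exact: measurable_Egker.
  - by move=> u _; rewrite mule_ge0// lee_fin// gker_ge0.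
  - by apply: emeasurable_funM => //; exact: measurable_Egker.
apply: ge0_le_integral => //.
- by move=> u _; rewrite lee_fin gker_ge0.
- exact: measurable_Egker.
- by apply: emeasurable_funD; apply: emeasurable_funM => //; exact: measurable_Egker.
- by move=> u _; rewrite -!EFinM -EFinD lee_fin; exact: gker_convex.
Qed.

(** Integrating [gker_concave] at s = 1 gives 1 + r <= r + Gamma(2 + r). *)
Lemma egamma_ge1 r : (0 <= r)%R -> 1 <= egamma (1 + 1 + r).
Proof.
move=> r0.
have e2 : egamma (1 + 1) = 1 :> \bar R by rewrite egammaS// egamma1 mule1.
have r10 : (0 <= 1 + r)%R by rewrite addr_ge0.
suff : (1 + r)%:E * egamma (1 + 1) <= r%:E * egamma 1 + egamma (1 + 1 + r).
  by rewrite e2 egamma1 !mule1 addrC EFinD leeD2lE.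
rewrite -!ge0_integralZl//.
- rewrite -ge0_integralD//.
  + apply: ge0_le_integral => //.
    * by move=> u _; rewrite -EFinM lee_fin mulr_ge0// gker_ge0.
    * by apply: emeasurable_funM => //; exact: measurable_Egker.
    * apply: emeasurable_funD; last exact: measurable_Egker.
      by apply: emeasurable_funM => //; exact: measurable_Egker.
    * by move=> u _; rewrite -!EFinM -EFinD lee_fin; exact: gker_concave.
  + by move=> u _; rewrite -EFinM lee_fin mulr_ge0// gker_ge0.
  + by apply: emeasurable_funM => //; exact: measurable_Egker.
  + by move=> u _; rewrite lee_fin gker_ge0.
  + exact: measurable_Egker.
- exact: measurable_Egker.
- by move=> u _; rewrite lee_fin gker_ge0.
- exact: measurable_Egker.
- by move=> u _; rewrite lee_fin gker_ge0.
Qed.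

(** On ]0, 1] the bound s Gamma(s) = Gamma(1 + s) <= 1 excludes the value +oo; the functional
    equation reaches larger s, by induction on an integer above s. *)
Lemma egamma_lty s : (0 < s)%R -> egamma s < +oo.
Proof.
move=> s0; have [n] : exists n : nat, (s <= n%:R)%R.
  by exists (Num.trunc s).+1; rewrite ltW// truncnS_gt.
elim: n s s0 => [s s0|n IH s s0 sn]; first by rewrite leNgt s0.
have [s1|s1] := leP s 1%R.
  have : egamma (1 + s) <= 1 by apply: egamma_le1; rewrite ltW.
  rewrite addrC egammaS//; have := egamma_ge0 s; case: (egamma s) => //.
    by move=> ? _ _; rewrite ltry.
  by move=> _; rewrite gt0_muley ?lte_fin// leye_eq.
rewrite -(subrK 1%R s) egammaS ?subr_gt0//.
rewrite lte_mul_pinfty ?lee_fin ?subr_ge0 1?ltW//.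
by apply: IH; rewrite ?subr_gt0// lerBlDr natr1.
Qed.

(** Were the value 0, the functional equation would make Gamma(2 + s) zero, against [egamma_ge1]. *)
Lemma egamma_gt0 s : (0 < s)%R -> 0 < egamma s.
Proof.
move=> s0; rewrite lt_neqAle egamma_ge0 andbT; apply/eqP => e0.
have := egamma_ge1 (ltW s0).
by rewrite addrC addrA egammaS ?addr_gt0// egammaS// -e0 !mule0 leNgt lte01.
Qed.

(** Both sides apply [fine] to the same integral; an infinite value becomes 0 on both. *)
Lemma Gamma_fine s : Gamma s = fine (egamma s).
Proof.
rewrite /Gamma /Rintegral integral_mkcond; congr fine; apply: eq_integral => t _.
rewrite patchE /gker; case: ltP => t0; last first.
  by rewrite ifF//; apply/negP; rewrite inE/= in_itv/= andbT ltNge t0.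
by rewrite ifT ?inE/= ?in_itv/= ?t0// /powR gt_eqF// -expRD.
Qed.

Lemma EFin_Gamma s : (0 < s)%R -> (Gamma s)%:E = egamma s.
Proof.
by move=> s0; rewrite Gamma_fine fineK// ge0_fin_numE ?egamma_ge0// egamma_lty.
Qed.

Lemma Gamma_ge0 s : (0 <= Gamma s)%R.
Proof. by rewrite Gamma_fine fine_ge0// egamma_ge0. Qed.

Lemma Gamma_gt0 s : (0 < s)%R -> (0 < Gamma s)%R.
Proof. by move=> s0; rewrite -lte_fin EFin_Gamma// egamma_gt0. Qed.

Lemma GammaS s : (0 < s)%R -> Gamma (s + 1) = (s * Gamma s)%R.
Proof.
by move=> s0; apply: EFin_inj; rewrite EFinM !EFin_Gamma ?addr_gt0// egammaS.
Qed.

Lemma Gamma_le1 r : (0 <= r <= 1)%R -> (Gamma (1 + r) <= 1)%R.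
Proof.
move=> r01; rewrite -lee_fin EFin_Gamma ?egamma_le1//.
by case/andP: r01 => r0 _; rewrite ltr_wpDr.
Qed.

(** Since (1 + r) Gamma(1 + r) = Gamma(2 + r) >= 1. *)
Lemma Gamma_ge_inv r : (0 <= r)%R -> ((1 + r)^-1 <= Gamma (1 + r))%R.
Proof.
move=> r0; have r1 : (0 < 1 + r)%R by rewrite ltr_wpDr.
rewrite -div1r ler_pdivrMr// mulrC -GammaS// -lee_fin EFin_Gamma ?(addr_gt0 r1)//.
by rewrite addrAC egamma_ge1.
Qed.

Lemma measurable_Gamma : measurable_fun setT (@Gamma R).
Proof.
rewrite (_ : Gamma = fine \o egamma); last by apply/funext => s; rewrite Gamma_fine.
by apply: measurableT_comp => //; exact: measurable_egamma.
Qed.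

End gamma_bounds.

(** * The gamma semigroup and its potential *)

Section gamma_density.
Context {R : realType}.
Local Open Scope ereal_scope.
Implicit Types (r s t u x y : R).

(** Extended by 0 to indices s <= 0 as well, so that integrals over the index run over the whole
    line and can be shifted. *)
Definition gdens s t : \bar R :=
  (if (0 < s)%R then gker s t / Gamma s else 0)%:E.

Lemma gdens_ge0 s t : 0 <= gdens s t.
Proof.
by rewrite /gdens lee_fin; case: ifP => // _; rewrite divr_ge0 ?gker_ge0 ?Gamma_ge0.
Qed.

Lemma gdens_npos s t : (t <= 0)%R -> gdens s t = 0.
Proof. by move=> t0; rewrite /gdens gker_npos// mul0r if_same. Qed.

Lemma gdensE s t : (0 < s)%R -> gdens s t = (gker s t / Gamma s)%:E.
Proof. by rewrite /gdens => ->. Qed.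

Lemma gdens_index_npos s t : (s <= 0)%R -> gdens s t = 0.
Proof. by rewrite /gdens ltNge => ->. Qed.

Lemma measurable_gdens2 : measurable_fun setT (fun z : R * R => gdens z.1 z.2).
Proof.
apply/measurable_EFinP; apply: measurable_fun_ifT => //.
  exact: measurable_fun_ltr.
apply: measurable_funM; first exact: measurable_gker2.
under eq_fun do rewrite -powR_inv1 ?Gamma_ge0//.
apply: (measurableT_comp (measurable_powR _)).
by apply: (measurableT_comp measurable_Gamma).
Qed.

Lemma measurable_gdens s : measurable_fun setT (gdens s).
Proof.
by have := measurable_fun_pair2 s measurable_gdens2.
Qed.

(** The exponentials merge into e^(-l t) and [egamma_scale] applies. This Laplace transform gives
    mass one at l = 1 and the integrability of the damped potential at l = 2. *)
Lemma gdens_scale s l : (0 < s)%R -> (0 < l)%R ->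
  \int[mu]_t ((expR (- ((l - 1) * t)))%:E * gdens s t) = (expR (- (s * ln l)))%:E.
Proof.
move=> s0 l0.
transitivity (\int[mu]_t ((Gamma s)^-1%:E *
    (if 0 < t then expR ((s - 1) * ln t - l * t) else 0)%:E)).
  apply: eq_integral => t _; rewrite gdensE// -!EFinM; congr EFin.
  rewrite mulrA mulrC; congr (_ * _)%R; rewrite /gker; case: ifP => _; last by rewrite mulr0.
  by rewrite -expRD; congr expR; ring.
rewrite ge0_integralZl//.
- rewrite egamma_scale// -EFin_Gamma// muleCA -!EFinM mulVf ?mulr1//.
  by rewrite gt_eqF// Gamma_gt0.
- apply/measurable_EFinP; apply: measurable_fun_ifT => //; first exact: measurable_fun_ltr.
  apply: measurableT_comp => //; apply: measurable_funB; last exact: measurable_funM.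
  by apply: measurable_funM => //; exact: measurable_ln.
- by move=> t _; rewrite lee_fin; case: ifP => // _; exact: expR_ge0.
- by rewrite lee_fin invr_ge0 Gamma_ge0.
Qed.

Lemma integral_gdens s : (0 < s)%R -> \int[mu]_t gdens s t = 1.
Proof.
move=> s0; have := @gdens_scale s 1%R s0 ltr01.
rewrite ln1 mulr0 oppr0 expR0 => <-; apply: eq_integral => t _.
by rewrite subrr mul0r oppr0 expR0 mul1e.
Qed.

Lemma integral_convol (f g : R -> \bar R) : measurable_fun setT f -> measurable_fun setT g ->
    (forall x, 0 <= f x) -> (forall x, 0 <= g x) ->
  \int[mu]_x convol f g x = (\int[mu]_x f x) * (\int[mu]_x g x).
Proof.
move=> mf mg f0 g0; rewrite /convol (ge0_integral_swap (k := fun x t => f (x - t)%R * g t)).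
- rewrite -ge0_integralZl//; last exact: ge0_integral0.
  apply: eq_integral => t _; under eq_integral do rewrite muleC.
  rewrite ge0_integralZl// ?(ge0_integral_shift (- t)%R)// 1?muleC//.
  by apply: (measurableT_comp mf); exact: measurable_funB.
- by apply: emeasurable_funM; [exact: measurable_shear|exact: measurableT_comp].
- by move=> *; exact: mule_ge0.
Qed.

(** The substitution t = x u takes all dependence on x out of the integral. The constant B is
    Gamma(r + s) / (Gamma(r) Gamma(s)) times the Beta integral, which is left unevaluated. *)
Lemma convol_gdens_prop r s : (0 < r)%R -> (0 < s)%R ->
  exists2 B, 0 <= B & forall x, convol (gdens r) (gdens s) x = B * gdens (r + s) x.
Proof.
move=> r0 s0.
pose b u : R := if (0 < u < 1)%R then expR ((r - 1) * ln (1 - u) + (s - 1) * ln u) else 0%R.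
have b0 u : 0 <= (b u)%:E by rewrite lee_fin /b; case: ifP => // _; exact: expR_ge0.
have mb : measurable_fun setT (fun u => (b u)%:E).
  apply/measurable_EFinP; apply: measurable_fun_ifT => //.
    by apply: measurable_and; exact: measurable_fun_ltr.
  apply: measurableT_comp => //; apply: measurable_funD.
    apply: measurable_funM; first by [].
    by apply: measurableT_comp; [exact: measurable_ln|exact: measurable_funB].
  by apply: measurable_funM; [|exact: measurable_ln].
have rs0 : (0 < r + s)%R by rewrite addr_gt0.
(* [Gamma] is abstracted because unification would otherwise unfold it. *)
have [gr Er] : exists g : R, Gamma r = g by exists (Gamma r).
have [gs Es] : exists g : R, Gamma s = g by exists (Gamma s).
have [grs Ers] : exists g : R, Gamma (r + s) = g by exists (Gamma (r + s)).
have gr0 : (0 < gr)%R by rewrite -Er Gamma_gt0.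
have gs0 : (0 < gs)%R by rewrite -Es Gamma_gt0.
have grs0 : (0 < grs)%R by rewrite -Ers Gamma_gt0.
exists ((grs / (gr * gs))%:E * \int[mu]_u (b u)%:E).
  apply: mule_ge0; last exact: ge0_integral0.
  by rewrite lee_fin divr_ge0 ?mulr_ge0// ltW.
move=> x; have [x0|x0] := leP x 0%R.
  rewrite gdens_npos// mule0 /convol integral0_eq// => t _.
  have [t0|t0] := leP t 0%R; first by rewrite [X in _ * X]gdens_npos ?mule0.
  by rewrite [X in X * _]gdens_npos ?mul0e// subr_le0 (le_trans x0)// ltW.
have mh : measurable_fun setT (fun t => gdens r (x - t)%R * gdens s t).
  apply: emeasurable_funM; last exact: measurable_gdens.
  by apply: (measurableT_comp (measurable_gdens r)); exact: measurable_funB.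
have h0 t : 0 <= gdens r (x - t)%R * gdens s t by rewrite mule_ge0// gdens_ge0.
have := ge0_integral_affine 0%R x0 mh h0.
rewrite -/(convol _ _ _) => /(congr1 (fun z => x%:E * z)).
rewrite muleA -EFinM divff ?gt_eqF// mul1e => <-.
transitivity ((x * expR ((r + s - 2) * ln x - x) / (gr * gs))%:E *
   \int[mu]_u (b u)%:E).
  rewrite -!ge0_integralZl//.
  - apply: eq_integral => u _; rewrite !gdensE// Er Es -!EFinM; congr EFin.
    have -> : (x - (x * u + 0) = x * (1 - u))%R by ring.
    rewrite addr0 /gker !pmulr_rgt0// subr_gt0 /b andbC.
    case: ltP => u1 /=; last by rewrite !(mul0r, mulr0).
    case: ltP => u0 /=; last by rewrite !(mul0r, mulr0).
    rewrite !lnM ?posrE ?subr_gt0//.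
    have -> : expR ((r + s - 2) * ln x - x) =
      (expR ((r - 1) * (ln x + ln (1 - u)) - x * (1 - u)) *
      expR ((s - 1) * (ln x + ln u) - x * u) /
      expR ((r - 1) * ln (1 - u) + (s - 1) * ln u))%R.
      by rewrite -expRN -!expRD; congr expR; ring.
    by field; rewrite !gt_eqF ?expR_gt0.
  - by rewrite lee_fin !mulr_ge0 ?expR_ge0 ?invr_ge0 ?mulr_ge0// ltW.
  - by apply: (measurableT_comp mh); apply: measurable_funD => //; exact: measurable_funM.
  - by rewrite lee_fin ltW.
rewrite muleAC gdensE// Ers gkerE// -EFinM; congr (_%:E * _).
have -> : expR ((r + s - 1) * ln x - x) = (x * expR ((r + s - 2) * ln x - x))%R.
  by rewrite -[in X in (_ = X * _)%R](lnK x0) -expRD; congr expR; ring.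
by field; rewrite !gt_eqF.
Qed.

(** All three densities have mass one, so comparing total masses forces B = 1. *)
Lemma convol_gdens r s : (0 < r)%R -> (0 < s)%R ->
  convol (gdens r) (gdens s) = gdens (r + s).
Proof.
move=> r0 s0; have [B B0 BE] := convol_gdens_prop r0 s0; apply/funext => x.
rewrite BE; suff -> : B = 1 by rewrite mul1e.
have := @integral_convol (gdens r) (gdens s) (measurable_gdens r) (measurable_gdens s)
  (gdens_ge0 r) (gdens_ge0 s).
rewrite [X in _ = X * _](integral_gdens r0) [X in _ = _ * X](integral_gdens s0).
rewrite mule1 => <-.
rewrite -[LHS]mule1 -(@integral_gdens (r + s)) ?addr_gt0// -ge0_integralZl//.
- by apply: eq_integral => y _; rewrite BE.
- exact: measurable_gdens.
- by move=> y _; exact: gdens_ge0.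
Qed.

End gamma_density.

(** * The potential S of the gamma semigroup *)

Section gamma_potential.
Context {R : realType}.
Local Open Scope ereal_scope.
Implicit Types (r s t u x y : R).

Definition gpot t := \int[mu]_s gdens s t.

Lemma gpot_ge0 t : 0 <= gpot t.
Proof. by apply: ge0_integral0 => s; exact: gdens_ge0. Qed.

Lemma gpot_npos t : (t <= 0)%R -> gpot t = 0.
Proof. by move=> t0; apply: integral0_eq => s _; exact: gdens_npos. Qed.

Lemma measurable_gpot : measurable_fun setT gpot.
Proof.
apply: (measurable_integral_snd (k := fun t s => gdens s t)).
  by have := measurable_uncurry_swap measurable_gdens2.
by move=> *; exact: gdens_ge0.
Qed.

(** Integrated over t first, g_s becomes 2^(-s), whose integral over s > 0 is 1 / ln 2. Local
    integrability and almost everywhere finiteness of S come from this bound. *)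
Lemma gpot_damped_lty : \int[mu]_t ((expR (- t))%:E * gpot t) < +oo.
Proof.
have ln2 : (0 < ln 2 :> R)%R by rewrite ln_gt0// ltr1n.
(* The right-hand integrand is 2^(-t) for t > 0 and 0 otherwise; there t stands for the index of the
   semigroup. *)
have -> : \int[mu]_t ((expR (- t))%:E * gpot t) = \int[mu]_t (gker 1 (ln 2 * t + 0))%:E.
  transitivity (\int[mu]_t \int[mu]_s ((expR (- t))%:E * @gdens R s t)).
    apply: eq_integral => t _; rewrite ge0_integralZl//.
    - by have := measurable_fun_pair1 t measurable_gdens2.
    - by move=> s _; exact: gdens_ge0.
  rewrite (ge0_integral_swap (k := fun t s : R => (expR (- t))%:E * gdens s t)).
  - apply: eq_integral => s _; rewrite addr0.
    have [s0|s0] := leP s 0%R.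
      rewrite gker_npos; last by rewrite pmulr_rle0.
      by apply: integral0_eq => t _; rewrite gdens_index_npos ?mule0.
    rewrite gkerE ?mulr_gt0// subrr mul0r add0r mulrC -(gdens_scale s0 (ltr0n _ 2)).
    by apply: eq_integral => t _; rewrite (_ : 2 - 1 = 1 :> R)%R ?mul1r//; ring.
  - apply: emeasurable_funM;
    last exact: (measurable_uncurry_swap (k := @gdens R) measurable_gdens2).
    apply/measurable_EFinP; apply: measurableT_comp => //; exact: measurable_funN.
  - by move=> *; rewrite mule_ge0 ?gdens_ge0// lee_fin expR_ge0.
rewrite (@ge0_integral_affine R (ln 2) 0%R (fun t => (gker 1 t)%:E))//.
- by rewrite -/(egamma 1) egamma1 mule1 ltry.
- exact: measurable_Egker.
- by move=> t; rewrite lee_fin gker_ge0.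
Qed.

Lemma calS_gpot t : (0 < t)%R -> calS t = fine (gpot t).
Proof.
move=> t0; rewrite /calS /Rintegral.
have -> : gpot t = (expR (- t))%:E * \int[mu]_(s in `]0%R, +oo[) (t `^ (s - 1) / Gamma s)%:E.
  rewrite -ge0_integralZl//.
  - rewrite [RHS]integral_mkcond; apply: eq_integral => s _.
    rewrite patchE mem_setE/= in_itv/= andbT; case: ltP => s0; last first.
      by rewrite gdens_index_npos.
    rewrite gdensE// gkerE// /powR gt_eqF// -EFinM mulrA -expRD; congr (expR _ / _)%:E; ring.
  - apply/measurable_EFinP; apply: measurable_funS measurableT _ _ => //.
    apply: measurable_funM.
      by apply: (measurableT_comp (measurable_powRr t)); exact: measurable_funB.
    under eq_fun do rewrite -powR_inv1 ?Gamma_ge0//.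
    by apply: (measurableT_comp (measurable_powR _)); exact: measurable_Gamma.
  - by move=> s _; rewrite lee_fin divr_ge0 ?powR_ge0 ?Gamma_ge0.
(* If I is +oo both sides are 0, because [fine] sends +oo to 0. *)
set I := \int[mu]_(s in _) _.
have : 0 <= I by apply: integral_ge0 => s _; rewrite lee_fin divr_ge0 ?powR_ge0 ?Gamma_ge0.
case: I => [i||]//= _; by rewrite ?mulr0 ?gt0_muley ?lte_fin ?expR_gt0.
Qed.

End gamma_potential.

(** * The Sonine identity *)

Section sonine.
Context {R : realType}.
Local Open Scope ereal_scope.
Implicit Types (r s t u x y : R).

Definition heaviside t : \bar R := (if (0 < t)%R then 1 else 0)%:E.

Lemma heaviside_ge0 t : 0 <= heaviside t.
Proof. by rewrite lee_fin; case: ifP. Qed.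

Lemma measurable_heaviside : measurable_fun setT heaviside.
Proof.
by apply/measurable_EFinP; apply: measurable_fun_ifT => //; exact: measurable_fun_ltr.
Qed.

(** The distribution function F_s, written as a convolution so that associativity applies to it. *)
Definition gcdf s := convol heaviside (gdens s).

Lemma gcdf_ge0 s x : 0 <= gcdf s x.
Proof. by apply: convol_ge0 => ?; [exact: heaviside_ge0|exact: gdens_ge0]. Qed.

Lemma measurable_gcdf s : measurable_fun setT (gcdf s).
Proof.
apply: measurable_convol; [exact: measurable_heaviside|exact: measurable_gdens|
  exact: heaviside_ge0|exact: gdens_ge0].
Qed.

Lemma gcdf_index_npos s x : (s <= 0)%R -> gcdf s x = 0.
Proof. by move=> s0; apply: integral0_eq => t _; rewrite gdens_index_npos ?mule0. Qed.

Lemma measurable_gcdf_index x : measurable_fun setT (fun s => gcdf s x).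
Proof.
apply: (measurable_integral_snd (k := fun s t => heaviside (x - t)%R * gdens s t)).
  apply: emeasurable_funM; last exact: measurable_gdens2.
  apply: (measurableT_comp measurable_heaviside).
  by apply: measurable_funB => //; exact: measurable_snd.
by move=> *; rewrite mule_ge0 ?heaviside_ge0 ?gdens_ge0.
Qed.

(** The incomplete gamma function A_s, set to 0 for y <= 0. *)
Definition gtail s y : \bar R :=
  \int[mu]_u (if (0 < y)%R && (y <= u)%R then gker s u else 0)%:E.

Lemma gtail_integrand_ge0 s y u :
  0 <= (if (0 < y)%R && (y <= u)%R then gker s u else 0)%:E.
Proof. by rewrite lee_fin; case: ifP => // _; exact: gker_ge0. Qed.

Lemma measurable_gtail_integrand2 s : measurable_fun setT
  (fun z : R * R => (if (0 < z.1)%R && (z.1 <= z.2)%R then gker s z.2 else 0)%:E).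
Proof.
apply/measurable_EFinP; apply: measurable_fun_ifT => //.
  by apply: measurable_and; [exact: measurable_fun_ltr|exact: measurable_fun_ler].
exact: (measurableT_comp (measurable_gker s) measurable_snd).
Qed.

Lemma measurable_gtail_integrand s y : measurable_fun setT
  (fun u => (if (0 < y)%R && (y <= u)%R then gker s u else 0)%:E).
Proof.
apply/measurable_EFinP; apply: measurable_fun_ifT => //; last exact: measurable_gker.
by apply: measurable_and; [exact: measurable_fun_ltr|exact: measurable_fun_ler].
Qed.

Lemma gtail_ge0 s y : 0 <= gtail s y.
Proof. by apply: ge0_integral0 => u; exact: gtail_integrand_ge0. Qed.

Lemma measurable_gtail s : measurable_fun setT (gtail s).
Proof.
apply: (measurable_integral_snd
  (k := fun y u => (if (0 < y)%R && (y <= u)%R then gker s u else 0)%:E)).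
  exact: measurable_gtail_integrand2.
by move=> *; exact: gtail_integrand_ge0.
Qed.

(** For y > 0 the unit mass of g_s splits at y: the part above is A_s(y) / Gamma(s), the part below
    F_s(y). For y <= 0 all terms vanish. *)
Lemma gtail_gcdf s y : (0 < s)%R ->
  heaviside y = (Gamma s)^-1%:E * gtail s y + gcdf s y.
Proof.
move=> s0; rewrite {1}/heaviside; case: ltP => y0; last first.
  rewrite /gtail integral0_eq ?mule0 ?add0e; last by move=> u _; rewrite ltNge y0.
  rewrite /gcdf /convol integral0_eq// => t _.
  have [t0|t0] := leP t 0%R; first by rewrite gdens_npos ?mule0.
  by rewrite /heaviside ltNge subr_le0 (le_trans y0)/= ?mul0e// ltW.
rewrite -(integral_gdens s0) -ge0_integralZl//.
- rewrite /gcdf /convol -ge0_integralD//.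
  + apply: eq_integral => u _; rewrite gdensE// -!EFinM -EFinD y0/= subr_gt0.
    by case: ltP; rewrite ?mulr0 ?mul0r ?mul1r ?addr0 ?add0r// mulrC.
  + by move=> u _; rewrite mule_ge0 ?gtail_integrand_ge0// lee_fin invr_ge0 Gamma_ge0.
  + by apply: emeasurable_funM => //; exact: measurable_gtail_integrand.
  + by move=> *; rewrite mule_ge0 ?heaviside_ge0 ?gdens_ge0.
  + apply: emeasurable_funM; last exact: measurable_gdens.
    by apply: (measurableT_comp measurable_heaviside); exact: measurable_funB.
- exact: measurable_gtail_integrand.
- by move=> u _; exact: gtail_integrand_ge0.
- by rewrite lee_fin invr_ge0 Gamma_ge0.
Qed.

Lemma gcdf_le1 s y : (0 < s)%R -> gcdf s y <= 1.
Proof.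
move=> s0; apply: (@le_trans _ _ (heaviside y)).
  rewrite (gtail_gcdf y s0) leeDr// mule_ge0 ?gtail_ge0//.
  by rewrite lee_fin invr_ge0 Gamma_ge0.
by rewrite /heaviside; case: ifP => _; rewrite ?lexx ?lee01.
Qed.

(** On u >= y the factor u / y is at least 1, and it raises the index by one. At s = 0 the bound
    makes E1 finite. *)
Lemma gtail_le s y : (0 < y)%R -> gtail s y <= y^-1%:E * egamma (s + 1).
Proof.
move=> y0; rewrite -ge0_integralZl//.
- apply: ge0_le_integral => //.
  + by move=> u _; exact: gtail_integrand_ge0.
  + exact: measurable_gtail_integrand.
  + by apply: emeasurable_funM => //; exact: measurable_Egker.
  + move=> u _; rewrite -EFinM lee_fin y0/=; case: ifP => yu.
      by rewrite gkerS mulrCA -[leLHS]mulr1 ler_wpM2l ?gker_ge0// ler_pdivlMl// mulr1.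
    by rewrite mulr_ge0 ?gker_ge0// invr_ge0 ltW.
- exact: measurable_Egker.
- by move=> u _; rewrite lee_fin gker_ge0.
- by rewrite lee_fin invr_ge0 ltW.
Qed.

(* Markov's inequality: a gamma variable of parameter s has mean s. *)
Lemma gcdf_ge s x : (0 < s)%R -> (0 < x)%R -> (1 - s / x)%:E <= gcdf s x.
Proof.
move=> s0 x0; have G0 := Gamma_gt0 s0.
rewrite EFinB leeBlDr//.
have := gtail_gcdf x s0; rewrite /heaviside x0 => ->.
rewrite addeC leeD2l//.
apply: (@le_trans _ _ ((Gamma s)^-1%:E * (x^-1%:E * egamma (s + 1)))).
  by rewrite lee_wpmul2l ?gtail_le// lee_fin invr_ge0 ltW.
rewrite -EFin_Gamma ?addr_gt0// GammaS// -!EFinM lee_fin.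
move: (Gamma s) G0 => g g0.
by rewrite le_eqVlt; apply/orP; left; apply/eqP; field; rewrite !gt_eqF.
Qed.

(** On t < x the weight 1 is at most e^(x-t), which leads back to [gpot_damped_lty]. The finiteness
    justifies the cancellation in [convol_gtail_gpot]. *)
Lemma convol_heaviside_gpot_lty x : convol heaviside gpot x < +oo.
Proof.
apply: (@le_lt_trans _ _ ((expR x)%:E * \int[mu]_t ((expR (- t))%:E * gpot t))); last first.
  by rewrite lte_mul_pinfty ?lee_fin ?expR_ge0// gpot_damped_lty.
have me : measurable_fun setT (fun t : R => (expR (- t))%:E * gpot t).
  apply: emeasurable_funM; last exact: measurable_gpot.
  by apply/measurable_EFinP; apply: measurableT_comp => //; exact: measurable_funN.
have e0 t : 0 <= (expR (- t))%:E * gpot t.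
  by rewrite mule_ge0 ?gpot_ge0// lee_fin expR_ge0.
rewrite -ge0_integralZl//.
apply: ge0_le_integral => //.
- by move=> *; rewrite mule_ge0 ?heaviside_ge0 ?gpot_ge0.
- apply: emeasurable_funM; last exact: measurable_gpot.
  by apply: (measurableT_comp measurable_heaviside); exact: measurable_funB.
- by apply: emeasurable_funM.
- move=> t _; rewrite muleA -EFinM -expRD lee_wpmul2r ?gpot_ge0//.
  rewrite lee_fin; case: ifP => [xt|_]; last exact: expR_ge0.
  by rewrite -expR0 ler_expR ltW.
Qed.

End sonine.

(** * Telescoping and two-sided bounds for A_r * S *)

Section sonine_identity.
Context {R : realType}.
Local Open Scope ereal_scope.
Implicit Types (r s t u x y : R).

Lemma measurable_restr_index (k : R -> R -> \bar R) (p : R -> bool) :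
  measurable_fun setT (fun z : R * R => k z.1 z.2) -> measurable_fun setT p ->
  measurable_fun setT (fun z : R * R => if p z.1 then k z.1 z.2 else 0).
Proof.
move=> mk mp; apply: measurable_fun_ifT => //.
exact: (measurableT_comp mp measurable_fst).
Qed.

(** The semigroup law shifts the index by r under the integral that defines S. *)
Lemma convol_gdens_gpot r t : (0 < r)%R ->
  convol (gdens r) gpot t = \int[mu]_s (if (r < s)%R then gdens s t else 0).
Proof.
move=> r0; rewrite convol_integral//.
- rewrite -[RHS](@ge0_integral_shift _ r).
  + apply: eq_integral => s _; rewrite ltrDr; case: ltP => s0.
      by rewrite (convol_gdens r0 s0) addrC.
    by apply: integral0_eq => u _; rewrite (gdens_index_npos _ s0) mule0.
  + apply: measurable_fun_ifT => //; first exact: measurable_fun_ltr.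
    by have := measurable_fun_pair1 t measurable_gdens2.
  + by move=> s; case: ifP => // _; exact: gdens_ge0.
- exact: measurable_gdens.
- exact: measurable_gdens2.
- exact: gdens_ge0.
- exact: gdens_ge0.
Qed.

Lemma convol_gcdf_gpot r x : (0 < r)%R ->
  convol (gcdf r) gpot x = \int[mu]_s (if (r < s)%R then gcdf s x else 0).
Proof.
move=> r0; rewrite /gcdf -convolA; last 6 first.
- exact: measurable_heaviside.
- exact: measurable_gdens.
- exact: measurable_gpot.
- exact: heaviside_ge0.
- exact: gdens_ge0.
- exact: gpot_ge0.
rewrite (_ : convol (gdens r) gpot =
    fun t => \int[mu]_s (if (r < s)%R then gdens s t else 0)); last first.
  by apply/funext => t; exact: convol_gdens_gpot.
rewrite (convol_integral (k := fun s t => if (r < s)%R then gdens s t else 0)).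
- apply: eq_integral => s _; case: ifP => // _.
  by apply: integral0_eq => t _; rewrite mule0.
- exact: measurable_heaviside.
- apply: (measurable_restr_index (k := @gdens R)); first exact: measurable_gdens2.
  exact: measurable_fun_ltr.
- exact: heaviside_ge0.
- by move=> s t; case: ifP => // _; exact: gdens_ge0.
Qed.

(** The convolution 1 * S is split in two ways: by 1 = A_r / Gamma(r) + F_r, and by cutting the
    index at r. Both contain F_r * S, which is finite and cancels. *)
Lemma convol_gtail_gpot r x : (0 < r)%R ->
  (Gamma r)^-1%:E * convol (gtail r) gpot x =
  \int[mu]_s (if (s <= r)%R then gcdf s x else 0).
Proof.
move=> r0.
have Gi : 0 <= (Gamma r)^-1%:E by rewrite lee_fin invr_ge0 Gamma_ge0.
have mleft : measurable_fun setT (fun s => if (s <= r)%R then gcdf s x else 0).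
  apply: measurable_fun_ifT => //; first exact: measurable_fun_ler.
  exact: measurable_gcdf_index.
have mright : measurable_fun setT (fun s => if (r < s)%R then gcdf s x else 0).
  apply: measurable_fun_ifT => //; first exact: measurable_fun_ltr.
  exact: measurable_gcdf_index.
have total : convol heaviside gpot x = \int[mu]_s gcdf s x.
  rewrite (convol_integral (k := @gdens R))//.
  - exact: measurable_heaviside.
  - exact: measurable_gdens2.
  - exact: heaviside_ge0.
  - exact: gdens_ge0.
have split1 : convol heaviside gpot x =
    (Gamma r)^-1%:E * convol (gtail r) gpot x + convol (gcdf r) gpot x.
  rewrite (_ : heaviside = fun y => (Gamma r)^-1%:E * gtail r y + gcdf r y); last first.
    by apply/funext => y; exact: gtail_gcdf.
  rewrite convolDl.
  - congr (_ + _); rewrite /convol; under eq_integral do rewrite -muleA.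
    rewrite ge0_integralZl//.
    + apply: emeasurable_funM; last exact: measurable_gpot.
      by apply: (measurableT_comp (measurable_gtail r)); exact: measurable_funB.
    + by move=> *; rewrite mule_ge0 ?gtail_ge0 ?gpot_ge0.
  - by apply: emeasurable_funM => //; exact: measurable_gtail.
  - exact: measurable_gcdf.
  - exact: measurable_gpot.
  - by move=> *; rewrite mule_ge0 ?gtail_ge0.
  - exact: gcdf_ge0.
  - exact: gpot_ge0.
have split2 : convol heaviside gpot x =
    \int[mu]_s (if (s <= r)%R then gcdf s x else 0) + convol (gcdf r) gpot x.
  rewrite total convol_gcdf_gpot// -ge0_integralD//.
  - by apply: eq_integral => s _; case: ltP; rewrite ?adde0 ?add0e.
  - by move=> s _; case: ifP => // _; exact: gcdf_ge0.
  - by move=> s _; case: ifP => // _; exact: gcdf_ge0.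
have fin : convol (gcdf r) gpot x \is a fin_num.
  rewrite ge0_fin_numE; last by apply: convol_ge0; [exact: gcdf_ge0|exact: gpot_ge0].
  apply: le_lt_trans (convol_heaviside_gpot_lty x); rewrite split1 leeDr// mule_ge0//.
  by apply: convol_ge0; [exact: gtail_ge0|exact: gpot_ge0].
by rewrite -[LHS](addeK _ fin) -split1 split2 addeK.
Qed.

Lemma integral_itv_cst r c : (0 < r)%R -> (0 <= c)%R ->
  \int[mu]_s (if (0 < s)%R && (s <= r)%R then c else 0)%:E = (c * r)%:E.
Proof.
move=> r0 c0; transitivity (\int[mu]_(s in `]0%R, r]) (cst c%:E) s).
  rewrite [RHS]integral_mkcond; apply: eq_integral => s _.
  by rewrite patchE mem_setE/= in_itv/=; case: ifP.
rewrite integral_cst// [X in _ * X]lebesgue_measure_itv/= lte_fin r0 oppr0 adde0.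
by rewrite EFinM.
Qed.

(** The bound F_s <= 1 on 0 < s <= r makes the telescoped integral at most r, and r Gamma(r) =
    Gamma(1 + r). *)
Lemma convol_gtail_le r x : (0 < r)%R -> convol (gtail r) gpot x <= (Gamma (1 + r))%:E.
Proof.
move=> r0; have G0 := Gamma_gt0 r0.
suff : (Gamma r)^-1%:E * convol (gtail r) gpot x <= r%:E.
  by rewrite muleC lee_pdivrMr// addrC GammaS// EFinM.
rewrite convol_gtail_gpot// -[r in leRHS]mul1r -integral_itv_cst//.
apply: ge0_le_integral => //.
- by move=> s _; case: ifP => // _; exact: gcdf_ge0.
- apply: measurable_fun_ifT => //; first exact: measurable_fun_ler.
  exact: measurable_gcdf_index.
- apply/measurable_EFinP; apply: measurable_fun_ifT => //.
  by apply: measurable_and; [exact: measurable_fun_ltr|exact: measurable_fun_ler].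
- move=> s _; have [s0|s0]/= := ltP 0%R s; last by rewrite gcdf_index_npos ?if_same.
  by case: ifP => // _; exact: gcdf_le1.
Qed.

(** For s <= r Markov's inequality gives F_s(x) >= 1 - s / x >= 1 - r / x; r <= x keeps this
    constant nonnegative for the comparison of integrals. *)
Lemma convol_gtail_ge r x : (0 < r)%R -> (r <= x)%R ->
  (Gamma (1 + r) * (1 - r / x))%:E <= convol (gtail r) gpot x.
Proof.
move=> r0 rx; have G0 := Gamma_gt0 r0.
have x0 : (0 < x)%R := lt_le_trans r0 rx.
have rx1 : (0 <= 1 - r / x)%R by rewrite subr_ge0 ler_pdivrMr// mul1r.
suff : ((1 - r / x) * r)%:E <= (Gamma r)^-1%:E * convol (gtail r) gpot x.
  rewrite [leRHS]muleC lee_pdivlMr// -EFinM [(1 + r)%R]addrC GammaS//.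
  by rewrite (_ : _ * r * _ = r * Gamma r * (1 - r / x))%R//; ring.
rewrite convol_gtail_gpot// -integral_itv_cst//.
apply: ge0_le_integral => //.
- by move=> s _; rewrite lee_fin; case: ifP.
- apply/measurable_EFinP; apply: measurable_fun_ifT => //.
  by apply: measurable_and; [exact: measurable_fun_ltr|exact: measurable_fun_ler].
- apply: measurable_fun_ifT => //; first exact: measurable_fun_ler.
  exact: measurable_gcdf_index.
- move=> s _; have [s0|s0]/= := ltP 0%R s; last by rewrite gcdf_index_npos ?if_same.
  case: ifP => // sr; apply: le_trans (gcdf_ge s0 x0).
  by rewrite lee_fin lerD2l lerN2 ler_wpM2r// invr_ge0 ltW.
Qed.

End sonine_identity.

(** * The limit r -> 0 *)

Section sonine_limit.
Context {R : realType}.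
Local Open Scope ereal_scope.
Implicit Types (r s t u x y : R).

(* By Tonelli, A_r * S evaluated at x is the integral of gker r against gwin x,
   so that r only enters through the factor u^r. *)
Definition gwin x u := \int[mu]_t (if (0 < x - t)%R && (x - t <= u)%R then gpot t else 0).

Let win_ge0 x u t : 0 <= (if (0 < x - t)%R && (x - t <= u)%R then gpot t else 0).
Proof. by case: ifP => // _; exact: gpot_ge0. Qed.

Let measurable_win x : measurable_fun setT
  (fun z : R * R => if (0 < x - z.2)%R && (x - z.2 <= z.1)%R then gpot z.2 else 0).
Proof.
apply: measurable_fun_ifT => //.
  apply: measurable_and.
    by apply: measurable_fun_ltr => //; exact: measurable_funB.
  by apply: measurable_fun_ler => //; exact: measurable_funB.
exact: (measurableT_comp measurable_gpot measurable_snd).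
Qed.

Lemma gwin_ge0 x u : 0 <= gwin x u.
Proof. by apply: ge0_integral0 => t; exact: win_ge0. Qed.

Lemma measurable_gwin x : measurable_fun setT (gwin x).
Proof.
by apply: (measurable_integral_snd (k := fun u t =>
  if (0 < x - t)%R && (x - t <= u)%R then gpot t else 0)) => //; exact: measurable_win.
Qed.

(** The window lies in t < x, so 1 * S dominates. As a finite factor, [gwin x u] distributes over
    sums and passes through the limit r -> 0. *)
Lemma gwin_fin_num x u : gwin x u \is a fin_num.
Proof.
rewrite ge0_fin_numE ?gwin_ge0//; apply: le_lt_trans (convol_heaviside_gpot_lty x).
apply: ge0_le_integral => //.
- by have := measurable_fun_pair2 u (measurable_win x).
- apply: emeasurable_funM; last exact: measurable_gpot.
  by apply: (measurableT_comp measurable_heaviside); exact: measurable_funB.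
- move=> t _; rewrite /heaviside; case: ltP => _ /=; last by rewrite mul0e.
  by rewrite mul1e; case: ifP => // _; exact: gpot_ge0.
Qed.

Lemma convol_gtail_gpotE r x :
  convol (gtail r) gpot x = \int[mu]_u ((gker r u)%:E * gwin x u).
Proof.
pose k t u : \bar R :=
  (if (0 < x - t)%R && (x - t <= u)%R then gker r u else 0)%:E * gpot t.
have mk : measurable_fun setT (fun z : R * R => k z.1 z.2).
  apply: emeasurable_funM; last exact: (measurableT_comp measurable_gpot measurable_fst).
  apply/measurable_EFinP; apply: measurable_fun_ifT => //.
    apply: measurable_and.
      by apply: measurable_fun_ltr => //; exact: measurable_funB.
    by apply: measurable_fun_ler => //; exact: measurable_funB.
  exact: (measurableT_comp (measurable_gker r) measurable_snd).
have k0 t u : 0 <= k t u by rewrite mule_ge0 ?gtail_integrand_ge0 ?gpot_ge0.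
transitivity (\int[mu]_t \int[mu]_u k t u).
  apply: eq_integral => t _; rewrite muleC -ge0_integralZl//.
  - by apply: eq_integral => u _; rewrite muleC.
  - exact: measurable_gtail_integrand.
  - by move=> u _; exact: gtail_integrand_ge0.
  - exact: gpot_ge0.
rewrite (ge0_integral_swap (k := k))//; apply: eq_integral => u _.
rewrite -ge0_integralZl//.
- by apply: eq_integral => t _; rewrite /k; case: ifP; rewrite ?mule0 ?mul0e.
- by have := measurable_fun_pair2 u (measurable_win x).
- by rewrite lee_fin gker_ge0.
Qed.

Lemma measurable_gker_gwin r x : measurable_fun setT (fun u => (gker r u)%:E * gwin x u).
Proof. by apply: emeasurable_funM; [exact: measurable_Egker|exact: measurable_gwin]. Qed.

Lemma gker_gwin_ge0 r x u : 0 <= (gker r u)%:E * gwin x u.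
Proof. by rewrite mule_ge0 ?gwin_ge0// lee_fin gker_ge0. Qed.

(** Pointwise this is [gker_convex] at s = 0, with the weight 1 - r enlarged to 1. *)
Lemma convol_gtail_subconvex r x : (0 <= r <= 1)%R ->
  convol (gtail r) gpot x <= convol (gtail 0) gpot x + r%:E * convol (gtail 1) gpot x.
Proof.
move=> r01; have /andP[r0 r1] := r01.
rewrite [leLHS]convol_gtail_gpotE [X in _ <= X + _]convol_gtail_gpotE.
rewrite [X in _ <= _ + _ * X]convol_gtail_gpotE.
rewrite -ge0_integralZl ?lee_fin//; last 2 first.
- exact: measurable_gker_gwin.
- by move=> u _; exact: gker_gwin_ge0.
rewrite -ge0_integralD//; last 4 first.
- by move=> u _; exact: gker_gwin_ge0.
- exact: measurable_gker_gwin.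
- by move=> u _; rewrite mule_ge0 ?gker_gwin_ge0.
- by apply: emeasurable_funM => //; exact: measurable_gker_gwin.
apply: ge0_le_integral => //.
- by move=> u _; exact: gker_gwin_ge0.
- exact: measurable_gker_gwin.
- by apply: emeasurable_funD; [|apply: emeasurable_funM => //]; exact: measurable_gker_gwin.
move=> u _; rewrite muleA -muleDl ?gwin_fin_num// ?ge0_adde_def ?inE ?lee_fin ?mulr_ge0 ?gker_ge0//.
rewrite lee_wpmul2r ?gwin_ge0// -EFinM -EFinD lee_fin.
have := @gker_convex R 0 r u r01; rewrite !add0r => /le_trans; apply.
by rewrite lerD2r ler_piMl ?gker_ge0// gerBl.
Qed.

Lemma gker_cvg0 u : gker n.+1%:R^-1 u @[n --> \oo] --> gker 0 u.
Proof.
have [u0|u0] := leP u 0%R.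
  rewrite gker_npos//; under eq_fun do rewrite gker_npos//.
  exact: cvg_cst.
rewrite gkerE//; under eq_fun do rewrite gkerE//.
apply: continuous_cvg; first exact: continuous_expR.
apply: cvgB; last exact: cvg_cst.
apply: cvgMl; apply: cvgB; last exact: cvg_cst.
exact: cvg_harmonic.
Qed.

(** Fatou's lemma along r = 1 / (n + 1): written over [gwin], the integrands converge pointwise, and
    each integral is at most Gamma(1 + r) <= 1. *)
Lemma convol_gtail0_le1 x : convol (gtail 0) gpot x <= 1.
Proof.
rewrite convol_gtail_gpotE.
pose f n u := (gker n.+1%:R^-1 u)%:E * gwin x u.
have -> : \int[mu]_u ((gker 0 u)%:E * gwin x u) = \int[mu]_u limn_einf (f ^~ u).
  apply: eq_integral => u _; have vfin := gwin_fin_num x u.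
  have fu : f ^~ u @ \oo --> (gker 0 u)%:E * gwin x u.
    rewrite /f -(fineK vfin) -EFinM; under eq_fun do rewrite -EFinM.
    by apply: cvg_EFin; [near=> n|apply: cvgMl; exact: gker_cvg0].
  rewrite is_cvg_limn_einfE; first by apply/esym/cvg_lim.
  by apply/cvg_ex; eexists; exact: fu.
apply: le_trans (fatou _ _ _ _) _ => //.
- by move=> n; exact: measurable_gker_gwin.
- by move=> n u _; exact: gker_gwin_ge0.
rewrite limn_einf_lim; apply: lime_le; first exact: is_cvg_einfs.
near=> n; apply: le_trans (ereal_inf_lbound _) _.
  by exists n => //=.
rewrite /= /f -convol_gtail_gpotE.
have n0 : (0 < n.+1%:R^-1 :> R)%R by rewrite invr_gt0 ltr0n.
apply: le_trans (convol_gtail_le x n0) _; rewrite lee_fin Gamma_le1// ltW//=.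
by rewrite invf_le1 ?ler1n ?ltr0n.
Unshelve. all: by end_near. Qed.

Lemma convol_gtail0 x : (0 < x)%R -> convol (gtail 0) gpot x = 1.
Proof.
move=> x0; apply/eqP; rewrite eq_le convol_gtail0_le1/=.
have := convol_gtail0_le1 x; have m0 : 0 <= convol (gtail 0) gpot x.
  by apply: convol_ge0; [exact: gtail_ge0|exact: gpot_ge0].
(* Combines both estimates of A_r * S, using A_1 * S <= Gamma(2) <= 1 and Gamma(1 + r) >= 1 / (1 +
   r). *)
have key r : (0 < r)%R -> (r <= 1)%R -> (r <= x)%R ->
    ((1 - r / x) / (1 + r))%:E <= convol (gtail 0) gpot x + r%:E.
  move=> r0 r1 rx; have r01 : (0 <= r <= 1)%R by rewrite ltW.
  have mr : convol (gtail r) gpot x <= convol (gtail 0) gpot x + r%:E.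
    apply: (le_trans (convol_gtail_subconvex x r01)); rewrite leeD2l//.
    rewrite -[leRHS]mule1; apply: lee_wpmul2l; first by rewrite lee_fin ltW.
    apply: le_trans (convol_gtail_le x ltr01) _.
    by rewrite lee_fin Gamma_le1 ?ler01/=.
  apply: le_trans _ mr; apply: le_trans _ (convol_gtail_ge r0 rx).
  rewrite lee_fin mulrC ler_wpM2r//; last by apply/Gamma_ge_inv/ltW.
  by rewrite subr_ge0 ler_pdivrMr// mul1r.
case: (convol _ _ _) m0 key => [M||] M0 key; [|by []|by []].
rewrite !lee_fin => M1; rewrite leNgt; apply/negP => {}M1.
(* If M < 1, then [key] with M r <= r and r^2 <= r gives 1 - M <= r (3 + 1/x); the constant 4 makes
   r (4 + 1/x) <= 1 - M contradict this. *)
pose r : R := Num.min (Num.min 1 x)%R ((1 - M) / (4 + x^-1))%R.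
have xi : (0 < x^-1)%R by rewrite invr_gt0.
have c0 : (0 < 4 + x^-1)%R by rewrite addr_gt0.
have r0 : (0 < r)%R by rewrite !lt_min ltr01 x0 divr_gt0// subr_gt0.
have r1 : (r <= 1)%R by rewrite /r !ge_min lexx.
have rx : (r <= x)%R by rewrite /r !ge_min lexx orbT.
have rM : (r * (4 + x^-1) <= 1 - M)%R by rewrite -ler_pdivlMr// /r !ge_min lexx !orbT.
have := key r r0 r1 rx; rewrite -EFinD lee_fin ler_pdivrMr ?addr_gt0//.
rewrite leNgt => /negP; apply; rewrite lee_fin in M0.
move: (x^-1)%R xi rM => z z0 rM; clearbody r.
have : (M * r <= r)%R by rewrite ler_piMl// ltW.
have : (r * r <= r)%R by rewrite ler_piMl// ltW.
lra.
Qed.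

End sonine_limit.

(** * Composition of Volterra operators *)

Section volterra.
Context {R : realType}.
Implicit Types (t x y : R).

(** Tonelli's measurability result is applied to the positive and negative parts, as f has no fixed
    sign. *)
Lemma measurable_integral_signed (h : R -> R -> \bar R) :
  measurable_fun setT (fun z : R * R => h z.1 z.2) ->
  measurable_fun setT (fun t => \int[mu]_y h t y)%E.
Proof.
move=> mh.
rewrite (_ : (fun t => _) = (fun t => \int[mu]_y (h t)^\+ y - \int[mu]_y (h t)^\- y)%E);
  last by apply/funext => t; rewrite integralE.
apply: emeasurable_funB.
- apply: (measurable_integral_snd (k := fun t y => ((h t)^\+)%E y));
    last by move=> t y; exact: funepos_ge0.
  rewrite (_ : (fun z => _) = (fun z : R * R => h z.1 z.2)^\+%E); first exact: measurable_funepos.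
  by apply/funext => z; rewrite !funeposE.
- apply: (measurable_integral_snd (k := fun t y => ((h t)^\-)%E y));
    last by move=> t y; exact: funeneg_ge0.
  rewrite (_ : (fun z => _) = (fun z : R * R => h z.1 z.2)^\-%E); first exact: measurable_funeneg.
  by apply/funext => z; rewrite !funenegE.
Qed.

Variables (k l g : R -> R) (c x : R).
Hypotheses (mk : measurable_fun setT k) (ml : measurable_fun setT l).
Hypotheses (k0 : forall t, 0 <= k t) (l0 : forall t, 0 <= l t).
Hypotheses (kneg : forall t, t <= 0 -> k t = 0) (lneg : forall t, t <= 0 -> l t = 0).
Hypothesis klc : forall y, 0 < y -> convol (EFin \o k) (EFin \o l) y = c%:E.
Hypothesis intg : mu.-integrable setT (EFin \o g).
Hypothesis gx : forall y, x <= y -> g y = 0.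

Local Open Scope ereal_scope.

Let mg : measurable_fun setT g.
Proof. by apply/measurable_EFinP; exact: measurable_int intg. Qed.

Let h t y : \bar R := (k (x - t) * (l (t - y) * g y))%:E.

Let mlg : measurable_fun setT (fun z : R * R => l (z.1 - z.2) * g z.2)%R.
Proof.
apply: measurable_funM; last exact: (measurableT_comp mg measurable_snd).
by apply: (measurableT_comp ml); exact: measurable_funB.
Qed.

Let mh : measurable_fun setT (fun z : R * R => h z.1 z.2).
Proof.
apply/measurable_EFinP; apply: measurable_funM; last exact: mlg.
by apply: (measurableT_comp mk); exact: measurable_funB.
Qed.

Let kl_shift y : (y < x)%R -> \int[mu]_t (k (x - t) * l (t - y))%:E = c%:E.
Proof.
move=> yx; rewrite -(klc (y := (x - y)%R)) ?subr_gt0//.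
rewrite -[LHS](@ge0_integral_shift _ y).
- by apply: eq_integral => t _; rewrite addrK opprD addrCA addrC -addrA.
- apply/measurable_EFinP; apply: measurable_funM.
    by apply: (measurableT_comp mk); exact: measurable_funB.
  by apply: (measurableT_comp ml); exact: measurable_funB.
- by move=> t; rewrite lee_fin mulr_ge0.
Qed.

Let c0 : (0 <= c)%R.
Proof.
by rewrite -lee_fin -(klc ltr01); apply: convol_ge0 => t; rewrite lee_fin.
Qed.

Let mkl y : measurable_fun setT (fun t => (k (x - t) * l (t - y))%:E).
Proof.
apply/measurable_EFinP; apply: measurable_funM.
  by apply: (measurableT_comp mk); exact: measurable_funB.
by apply: (measurableT_comp ml); exact: measurable_funB.
Qed.

(** Tonelli for |h|, integrating over t first: [kl_shift] leaves c |g(y)|, which is integrable; for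
    y >= x everything vanishes with g. *)
Let inth : (mu \x mu).-integrable setT (fun z : R * R => h z.1 z.2).
Proof.
apply/(integrable21ltyP mu mu mh).
apply: (@le_lt_trans _ _ (\int[mu]_y (c%:E * `|(g y)%:E|))).
  rewrite le_eqVlt; apply/orP; left; apply/eqP; apply: eq_integral => y _.
  have [yx|xy] := ltP y x; last first.
    by rewrite gx// abse0 mule0; apply: integral0_eq => t _; rewrite /h gx// !mulr0 abse0.
  rewrite -(kl_shift yx) muleC -ge0_integralZl//.
  - apply: eq_integral => t _; rewrite /h mulrA EFinM abseM muleC.
    by rewrite [X in _ * X]gee0_abs// lee_fin mulr_ge0.
  - exact: mkl.
  - by move=> t _; rewrite lee_fin mulr_ge0.
rewrite ge0_integralZl ?lee_fin//.
- by rewrite lte_mul_pinfty ?lee_fin//; have /integrableP[] := intg.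
- by apply: measurableT_comp => //; apply/measurable_EFinP.
Qed.

(** Fubini: for fixed y < x, the integral over t of the product of the two kernels is the constant
    c. *)
Lemma volterra_comp :
  (\int[mu]_t (k (x - t) * \int[mu]_y (l (t - y) * g y)) = c * \int[mu]_y g y)%R.
Proof.
rewrite -RintegralZl//; congr fine.
transitivity (\int[mu]_t \int[mu]_y h t y).
  apply: ae_eq_integral => //.
  - apply/measurable_EFinP; apply: measurable_funM.
      by apply: (measurableT_comp mk); exact: measurable_funB.
    apply: measurableT_comp => //.
    apply: (measurable_integral_signed (h := fun t y => (l (t - y) * g y)%:E)).
    exact/measurable_EFinP.
  - exact: measurable_integral_signed.
  have := ae_integrable1 inth; apply: filterS => t /= it _.
  (* For almost every t the section of h is integrable. If k (x - t) = 0 both sides vanish;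
     otherwise dividing by it shows that the inner integral is finite, so that [fine] preserves
     it. *)
  have [k00|kn0] := eqVneq (k (x - t)%R) 0%R.
    by rewrite k00 mul0r; apply/esym/integral0_eq => y _; rewrite /h k00 mul0r.
  have il : mu.-integrable setT (fun y => (l (t - y) * g y)%:E).
    have := integrableZl measurableT (k (x - t)%R)^-1 it.
    apply: eq_integrable => // y _.
    by rewrite /h -EFinM mulKf.
  rewrite EFinM fineK; last exact: integrable_fin_num.
  by rewrite -integralZl//; apply: eq_integral => y _.
rewrite (@Fubini _ _ _ _ _ mu mu (fun z => h z.1 z.2) inth).
apply: eq_integral => y _ /=.
have [yx|xy] := ltP y x; last first.
  by rewrite gx// mulr0; apply: integral0_eq => t _; rewrite /h gx// !mulr0.
rewrite EFinM -(kl_shift yx) -integralZr//.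
  by apply: eq_integral => t _; rewrite /h mulrA.
apply/integrableP; split; first exact: mkl.
under eq_integral do rewrite gee0_abs ?lee_fin ?mulr_ge0//.
by rewrite kl_shift// ltry.
Qed.

End volterra.

(** * Real-valued kernels and their dilations *)

Section kernels.
Context {R : realType}.
Implicit Types (t u x y alpha : R).

Lemma gtail0_fin_num t : gtail 0 t \is a fin_num.
Proof.
rewrite ge0_fin_numE ?gtail_ge0//; have [t0|t0] := ltP 0 t.
  by apply: le_lt_trans (gtail_le 0 t0) _; rewrite add0r egamma1 mule1 ltry.
by rewrite /gtail integral0_eq// => u _; rewrite ltNge t0.
Qed.

Lemma gker0 u : 0 < u -> gker 0 u = expR (- u) / u.
Proof.
by move=> u0; rewrite gkerE// sub0r mulN1r addrC expRD [expR (- ln _)]expRN lnK.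
Qed.

Lemma E1_gtail t : 0 < t -> E1 t = fine (gtail 0 t).
Proof.
move=> t0; rewrite /E1 /Rintegral; congr fine.
transitivity (\int[mu]_(u in `]t, +oo[) (gker 0 u)%:E)%E.
  apply: eq_integral => u; rewrite inE/= in_itv/= andbT => tu.
  by rewrite gker0// (lt_trans t0).
rewrite integral_itv_obnd_cbnd; last first.
  exact: (measurable_funS measurableT (@subsetT _ _) (@measurable_Egker R 0)).
rewrite integral_mkcond; apply: eq_integral => u _.
by rewrite patchE mem_setE/= in_itv/= andbT t0/=; case: ifP.
Qed.

Lemma integrable_damped_gpot :
  mu.-integrable setT (fun t : R => (expR (- t))%:E * gpot t)%E.
Proof.
apply/integrableP; split.
  apply: emeasurable_funM; last exact: measurable_gpot.
  by apply/measurable_EFinP; apply: measurableT_comp => //; exact: measurable_funN.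
under eq_integral do rewrite gee0_abs ?mule_ge0 ?gpot_ge0 ?lee_fin ?expR_ge0//.
exact: gpot_damped_lty.
Qed.

(** Real kernels on the whole line, zero for t <= 0, that agree with [E1] and [calS] for t > 0. *)
Definition E1k t : R := fine (gtail 0 t).
Definition Sk t : R := fine (gpot t).

Lemma E1k_ge0 t : 0 <= E1k t. Proof. by rewrite fine_ge0 ?gtail_ge0. Qed.

Lemma Sk_ge0 t : 0 <= Sk t. Proof. by rewrite fine_ge0 ?gpot_ge0. Qed.

Lemma E1k_npos t : t <= 0 -> E1k t = 0.
Proof.
by move=> t0; rewrite /E1k /gtail integral0_eq// => u _; rewrite ltNge t0.
Qed.

Lemma Sk_npos t : t <= 0 -> Sk t = 0.
Proof. by move=> t0; rewrite /Sk gpot_npos. Qed.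

Lemma measurable_E1k : measurable_fun setT E1k.
Proof. by apply: measurableT_comp => //; exact: measurable_gtail. Qed.

Lemma measurable_Sk : measurable_fun setT Sk.
Proof. by apply: measurableT_comp => //; exact: measurable_gpot. Qed.

Let mES x : measurable_fun setT (fun t => (E1k (x - t) * Sk t)%:E).
Proof.
apply/measurable_EFinP; apply: measurable_funM; last exact: measurable_Sk.
by apply: (measurableT_comp measurable_E1k); exact: measurable_funB.
Qed.

(** Passing to real values changes S only where it is infinite, a null set because e^(-t) S(t) is
    integrable; so [convol_gtail0] carries over. *)
Lemma convol_E1_S x : 0 < x -> convol (EFin \o E1k) (EFin \o Sk) x = 1%E.
Proof.
move=> x0; rewrite -(convol_gtail0 x0); apply: ge0_ae_eq_integral => //.
- exact: mES.
- apply: emeasurable_funM; last exact: measurable_gpot.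
  by apply: (measurableT_comp (measurable_gtail 0)); exact: measurable_funB.
- by move=> t _; rewrite lee_fin mulr_ge0 ?E1k_ge0 ?Sk_ge0.
- by move=> t _; rewrite mule_ge0 ?gtail_ge0 ?gpot_ge0.
have := integrable_ae measurableT integrable_damped_gpot.
apply: filterS => t /(_ I) fin _ /=; rewrite /E1k /Sk !fineK ?gtail0_fin_num//.
by move: fin; case: (gpot t) => //;
  rewrite ?gt0_muley ?gt0_muleNy ?lte_fin ?expR_gt0.
Qed.

Definition dil alpha (k : R -> R) t := k (t / alpha).

Lemma measurable_dil alpha (k : R -> R) :
  measurable_fun setT k -> measurable_fun setT (dil alpha k).
Proof. by move=> mk; apply: (measurableT_comp mk); exact: measurable_funM. Qed.

(** The substitution t = alpha u produces the factor alpha, which the prefactor of [fracJ] will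
    cancel. *)
Lemma convol_dil alpha x : 0 < alpha -> 0 < x ->
  convol (EFin \o dil alpha E1k) (EFin \o dil alpha Sk) x = alpha%:E.
Proof.
move=> alpha_gt0 x0; have ai : 0 < alpha^-1 by rewrite invr_gt0.
pose h u : \bar R := (E1k (x / alpha - u) * Sk u)%:E.
transitivity (\int[mu]_t h (alpha^-1 * t + 0)%R)%E.
  apply: eq_integral => t _; rewrite /h /= /dil addr0 -EFinM.
  by rewrite mulrBl [t / _]mulrC.
rewrite (@ge0_integral_affine R alpha^-1 0 h)//.
- by rewrite invrK -[RHS]mule1 -(convol_E1_S (divr_gt0 x0 alpha_gt0)).
- exact: mES.
- by move=> t; rewrite lee_fin mulr_ge0 ?E1k_ge0 ?Sk_ge0.
Qed.

End kernels.

(** * Composition on an interval and the inversion theorem *)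

Section statement.
Context {R : realType}.
Variables (a b : R) (f : R -> R).
Hypothesis intf : mu.-integrable `[a, b] (EFin \o f).

(** With f cut to ]a, x[ and kernels vanishing on t <= 0, the interval integrals become integrals
    over the line and [volterra_comp] applies. *)
Lemma volterra_comp_itv (k l : R -> R) c x :
    measurable_fun setT k -> measurable_fun setT l ->
    (forall t, 0 <= k t) -> (forall t, 0 <= l t) ->
    (forall t, t <= 0 -> k t = 0) -> (forall t, t <= 0 -> l t = 0) ->
    (forall y, 0 < y -> convol (EFin \o k) (EFin \o l) y = c%:E) ->
    x \in `[a, b] ->
  \int[mu]_(t in `]a, x[) (k (x - t) * \int[mu]_(y in `]a, t[) (l (t - y) * f y)) =
  c * \int[mu]_(y in `[a, x]) f y.
Proof.
move=> mk ml k0 l0 kneg lneg klc; rewrite in_itv/= => /andP[ax xb].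
have iax : mu.-integrable `]a, x[ (EFin \o f).
  apply: integrableS intf => //; apply: subset_itv; by rewrite bnd_simp.
pose g := f \_ `]a, x[.
have gE y : g y = if (a < y < x) then f y else 0.
  by rewrite /g patchE mem_setE/= in_itv.
(* Cutting f at x instead of t is harmless, because l (t - y) vanishes for y >= t. *)
have inner t : t <= x ->
    \int[mu]_(y in `]a, t[) (l (t - y) * f y) = \int[mu]_y (l (t - y) * g y).
  move=> tx; rewrite [LHS]Rintegral_mkcond; congr fine; apply: eq_integral => y _; congr EFin.
  rewrite patchE mem_setE/= in_itv/= gE.
  have [yt|ty] := ltP y t; last by rewrite andbF lneg ?mul0r// subr_le0.
  by rewrite (lt_le_trans yt tx) !andbT; case: ifP => // _; rewrite mulr0.
transitivity (\int[mu]_t (k (x - t) * \int[mu]_y (l (t - y) * g y))).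
  rewrite [LHS]Rintegral_mkcond; congr fine; apply: eq_integral => t _; congr EFin.
  rewrite patchE mem_setE/= in_itv/=.
  have [tx|xt] := ltP t x; last by rewrite andbF kneg ?mul0r// subr_le0.
  rewrite andbT; case: ltP => ta; first by rewrite inner// ltW.
  (* For t <= a the inner integrand vanishes: g y = 0 for y < t, and l (t - y) = 0 for y >= t. *)
  rewrite (_ : \int[mu]_y _ = 0) ?mulr0// /Rintegral integral0_eq// => y _.
  rewrite gE; have [yt|ty] := ltP y t; last by rewrite lneg ?mul0r// subr_le0.
  by rewrite ltNge (le_trans (ltW yt) ta)/= mulr0.
rewrite (@volterra_comp _ k l g c x)//.
- rewrite -Rintegral_mkcond; congr (c * fine _).
  rewrite [RHS]integral_itv_bndoo//.
  exact: measurable_int iax.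
- rewrite /g -restrict_EFin.
  by have [+ _] := @integrable_mkcond _ _ R mu _ (EFin \o f) (measurable_itv `]a, x[); apply.
- by move=> y xy; rewrite gE [y < x]ltNge xy andbF.
Qed.

End statement.

Unset Implicit Arguments.

Theorem theorem3p4 (R : realType) (alpha a b : R)
    (alpha_gt0 : 0 < alpha) (ltab : a < b) (f : R -> R)
    (intf : lebesgue_measure.-integrable `[a, b] (EFin \o f)) :
  {ae lebesgue_measure, forall x : R, x \in `[a, b] ->
    fracJ alpha a (fracS alpha a f) x = fracS alpha a (fracJ alpha a f) x /\
    fracS alpha a (fracJ alpha a f) x =
      \int[lebesgue_measure]_(y in `[a, x]) f y}.
Proof.
apply: aeW => x xab.
have ai0 : 0 <= alpha^-1 by rewrite invr_ge0 ltW.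
have aneq0 : alpha != 0 by rewrite gt_eqF.
pose k := dil alpha (@E1k R); pose l := dil alpha (@Sk R).
have dil_npos (h : R -> R) : (forall t, t <= 0 -> h t = 0) ->
    forall t, t <= 0 -> dil alpha h t = 0.
  by move=> h0 t t0; rewrite /dil h0// pmulr_lle0// invr_gt0.
have kE z t : t < z -> E1 ((z - t) / alpha) = k (z - t).
  by move=> tz; rewrite E1_gtail// divr_gt0// subr_gt0.
have lE z t : t < z -> calS ((z - t) / alpha) = l (z - t).
  by move=> tz; rewrite calS_gpot// divr_gt0// subr_gt0.
have mk : measurable_fun setT k by apply: measurable_dil; exact: measurable_E1k.
have ml : measurable_fun setT l by apply: measurable_dil; exact: measurable_Sk.
have k0 t : 0 <= k t by exact: E1k_ge0.
have l0 t : 0 <= l t by exact: Sk_ge0.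
have knpos t : t <= 0 -> k t = 0 by apply: dil_npos; exact: E1k_npos.
have lnpos t : t <= 0 -> l t = 0 by apply: dil_npos; exact: Sk_npos.
have JE g z : fracJ alpha a g z =
    alpha^-1 * \int[lebesgue_measure]_(t in `]a, z[) (k (z - t) * g t).
  rewrite /fracJ /Rintegral; congr (_ * fine _); apply: eq_integral => t.
  rewrite inE/= in_itv/= => /andP[_ tz].
  by rewrite kE.
have SE g z : fracS alpha a g z =
    \int[lebesgue_measure]_(t in `]a, z[) (l (z - t) * g t).
  congr fine; apply: eq_integral => t.
  rewrite inE/= in_itv/= => /andP[_ tz].
  by rewrite lE.
have -> : fracS alpha a (fracJ alpha a f) x = \int[lebesgue_measure]_(y in `[a, x]) f y.
  rewrite SE.
  (* The prefactor of the inner [fracJ] moves into the outer kernel, so that the constant becomes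
     1. *)
  transitivity (\int[lebesgue_measure]_(t in `]a, x[) (alpha^-1 * l (x - t) *
     \int[lebesgue_measure]_(y in `]a, t[) (k (t - y) * f y))).
    by congr fine; apply: eq_integral => t _; rewrite JE mulrCA mulrA.
  rewrite (volterra_comp_itv intf (k := fun t => alpha^-1 * l t) (l := k) (c := 1))//.
  - by rewrite mul1r.
  - exact: measurable_funM.
  - by move=> t; rewrite mulr_ge0.
  - by move=> t t0; rewrite lnpos ?mulr0.
  - move=> y y0; transitivity (alpha^-1%:E * convol (EFin \o l) (EFin \o k) y)%E.
      rewrite /convol -ge0_integralZl//.
      + by apply: eq_integral => t _; rewrite /= EFinM muleA.
      + apply/measurable_EFinP; apply: measurable_funM; last exact: mk.
        by apply: (measurableT_comp ml); exact: measurable_funB.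
      + by move=> t _; rewrite lee_fin mulr_ge0.
    rewrite (@convolC R (EFin \o l) (EFin \o k)); last 4 first.
    + exact/measurable_EFinP.
    + exact/measurable_EFinP.
    + by move=> t; rewrite lee_fin.
    + by move=> t; rewrite lee_fin.
    by rewrite convol_dil// -EFinM mulVf.
split=> //; rewrite JE.
(* In this order the constant is alpha, and the prefactor stays outside to cancel it. *)
transitivity (alpha^-1 * (alpha * \int[lebesgue_measure]_(y in `[a, x]) f y)).
  congr (_ * _); rewrite -(volterra_comp_itv intf mk ml k0 l0 knpos lnpos _ xab).
    by congr fine; apply: eq_integral => t _; rewrite SE.
  by move=> y y0; exact: convol_dil.
by rewrite mulKf.
Qed.
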